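(* The Banach algebra $\mathcal A=\ell^1(\mathbb Z)$, equipped with the convolution product, has stable rank one. For any non-principal ultrafilter $\mathcal U$ on $\mathbb N$, the ultrapower $(\mathcal A)_{\mathcal U}$ does not have stable rank one, and hence also $\mathrm{Asy}(\mathcal A)$ and $\ell^\infty(\mathcal A)$ do not have stable rank one.
   Context: Complex scalars are used. For a Banach algebra $\mathcal A$, $\ell^\infty(\mathcal A)$ is the Banach algebra of all bounded sequences in $\mathcal A$ indexed by $\mathbb N$, with pointwise operations and the supremum norm; $c_0(\mathcal A)$ is the closed two-sided ideal of sequences converging to $0$ in norm; $\mathrm{Asy}(\mathcal A)=\ell^\infty(\mathcal A)/c_0(\mathcal A)$; for a non-principal ultrafilter $\mathcal U$ on $\mathbb N$, $c_{\mathcal U}(\mathcal A)$ is the closed two-sided ideal of bounded sequences $(a_n)$ with $\lim_{n\to\mathcal U}\|a_n\|=0$, and the ultrapower is $(\mathcal A)_{\mathcal U}=\ell^\infty(\mathcal A)/c_{\mathcal U}(\mathcal A)$; quotients carry the quotient norm. A unital Banach algebra has stable rank one if its group of invertible elements is norm dense in it. *)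

(* Defs.v *)
From HB Require Import structures.
From mathcomp Require Import all_boot all_order all_algebra.
From mathcomp Require Import complex lra.
From mathcomp Require Import all_classical all_reals all_analysis.
Set Implicit Arguments.
Unset Strict Implicit.
Unset Printing Implicit Defensive.
Import Order.TTheory GRing.Theory Num.Theory numFieldNormedType.Exports.
Local Open Scope classical_set_scope.
Local Open Scope ring_scope.
Local Open Scope complex_scope.

Section Norm.
Variable R : realType.

(* In a [normedModType R[i]] the norm is a (real) element of [R[i]]; [rnorm] is
   the same number seen in [R], where suprema, infima and [\esum] live. *)
Definition rnorm (V : semiNormedZmodType R[i]) (x : V) : R := complex.Re `|x|.

Section Semi.
Variable V : semiNormedZmodType R[i].
Implicit Types x y : V.

Lemma rnormE x : `|x| = (rnorm x)%:C.
Proof. by rewrite /rnorm RRe_real // ger0_real. Qed.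

Lemma rnorm_ge0 x : 0 <= rnorm x.
Proof. by rewrite -lecR -rnormE; exact: normr_ge0. Qed.

Lemma rnorm0 : rnorm (0 : V) = 0.
Proof. by apply: complexI; rewrite -rnormE normr0. Qed.

Lemma rnormD x y : rnorm (x + y) <= rnorm x + rnorm y.
Proof. by rewrite -lecR rmorphD /= -!rnormE ler_normD. Qed.

Lemma rnormN x : rnorm (- x) = rnorm x.
Proof. by apply: complexI; rewrite -!rnormE normrN. Qed.

Lemma rnorm_distC x y : rnorm (x - y) = rnorm (y - x).
Proof. by rewrite -rnormN opprB. Qed.

Lemma rnormB x y : rnorm (x - y) <= rnorm x + rnorm y.
Proof. by rewrite -(rnormN y) rnormD. Qed.
End Semi.

Lemma rnormM (c d : R[i]) : rnorm (c * d) = rnorm c * rnorm d.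
Proof. by apply: complexI; rewrite rmorphM /= -!rnormE normrM. Qed.

Lemma rnorm1 : rnorm (1 : R[i]) = 1.
Proof. by apply: complexI; rewrite -!rnormE normr1. Qed.

Lemma rnorm_real (x : R) : 0 <= x -> rnorm x%:C = x.
Proof. by move=> x0; apply: complexI; rewrite -rnormE ger0_norm ?lecR. Qed.

Lemma rnorm_eq0 (V : normedZmodType R[i]) (x : V) : rnorm x = 0 -> x = 0.
Proof. by move=> x0; apply: normr0_eq0; rewrite rnormE x0. Qed.

Lemma rnormZ (V : normedModType R[i]) c (x : V) :
  rnorm (c *: x) = rnorm c * rnorm x.
Proof. by apply: complexI; rewrite rmorphM /= -!rnormE normrZ. Qed.

Lemma ler_Re_rnorm (c : R[i]) : `|complex.Re c| <= rnorm c.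
Proof. by rewrite -lecR -rnormE normc_ge_Re. Qed.

Lemma ler_Im_rnorm (c : R[i]) : `|complex.Im c| <= rnorm c.
Proof.
have := ler_Re_rnorm ('i * c); rewrite rnormM.
have -> : rnorm ('i : R[i]) = 1.
  by rewrite /rnorm normc_def /= expr0n/= add0r expr1n sqrtr1.
by case: c => a b /=; rewrite !mul0r mul1r sub0r normrN mul1r.
Qed.

End Norm.

Section Sums.
Variable R : realType.

(* Unconditional sums of absolutely summable families, by splitting into real and
   imaginary, then positive and negative, parts. The values on families that are
   not absolutely summable are junk and are never used. *)
Definition rsum (T : choiceType) (f : T -> R) : R :=
  fine (\esum_(i in [set: T]) (EFin \o f)^\+ i
        - \esum_(i in [set: T]) (EFin \o f)^\- i)%E.

Definition csum (T : choiceType) (f : T -> R[i]) : R[i] :=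
  rsum (fun i => complex.Re (f i)) +i* rsum (fun i => complex.Im (f i)).

Definition csummable (T : choiceType) (V : semiNormedZmodType R[i])
    (f : T -> V) : Prop :=
  summable [set: T] (fun i => (rnorm (f i))%:E).

Local Notation E g := (\esum_(i in setT) (g i)%:E)%E.
Local Notation summ g := (summable setT (fun i => (g i)%:E)).

Section Real.
Variable T : choiceType.
Implicit Types f g h : T -> R.

Definition ssum g : R := fine (E g).

Lemma summE g : (forall i, 0 <= g i) -> summ g <-> (E g < +oo)%E.
Proof.
move=> g0; rewrite /summable; under eq_esum do rewrite gee0_abs ?lee_fin//.
by [].
Qed.

Lemma ssumE g : (forall i, 0 <= g i) -> summ g -> E g = (ssum g)%:E.
Proof.
move=> g0 /(summE g0) gf; rewrite /ssum fineK// ge0_fin_numE//.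
by apply: esum_ge0 => i _; rewrite lee_fin.
Qed.

Lemma summ_le f g : (forall i, `|f i| <= g i) -> summ g -> summ f.
Proof.
move=> fg; apply: le_lt_trans; apply: le_esum => i _ /=.
by rewrite lee_fin (le_trans (fg i)) ?ler_norm.
Qed.

Lemma eq_summ f g : f =1 g -> summ f -> summ g.
Proof. by move=> /funext ->. Qed.

Lemma summ_norm f : summ f -> summ (fun i => `|f i|).
Proof. by apply: le_lt_trans; apply: le_esum => i _ /=; rewrite normr_id. Qed.

Lemma summD f g : summ f -> summ g -> summ (fun i => f i + g i).
Proof. by move=> /summableD sf /sf. Qed.

Lemma summN f : summ f -> summ (fun i => - f i).
Proof. by rewrite summableN. Qed.

Lemma summB f g : summ f -> summ g -> summ (fun i => f i - g i).
Proof. by move=> sf sg; apply: summD => //; apply: summN. Qed.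

Lemma le_ssum f g : (forall i, 0 <= f i <= g i) -> summ g -> ssum f <= ssum g.
Proof.
move=> fg sg; have f0 i : 0 <= f i by have /andP[] := fg i.
have g0 i : 0 <= g i by apply: le_trans (f0 i) _; have /andP[] := fg i.
have sf : summ f.
  by apply: summ_le sg => i; rewrite ger0_norm//; have /andP[] := fg i.
rewrite -lee_fin -!ssumE//; apply: le_esum => i _; rewrite lee_fin.
by have /andP[] := fg i.
Qed.

Lemma ssum_ge0 f : (forall i, 0 <= f i) -> 0 <= ssum f.
Proof. by move=> f0; apply: fine_ge0; apply: esum_ge0 => i _; rewrite lee_fin. Qed.

Lemma ssumD f g : (forall i, 0 <= f i) -> (forall i, 0 <= g i) ->
  summ f -> summ g -> ssum (fun i => f i + g i) = ssum f + ssum g.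
Proof.
move=> f0 g0 sf sg; apply: EFin_inj; rewrite EFinD -!ssumE//.
- by rewrite -esumD// => i _; rewrite lee_fin.
- by move=> i; rewrite addr_ge0.
- exact: summD.
Qed.

Lemma rsum_posB g h : (forall i, 0 <= g i) -> (forall i, 0 <= h i) ->
  summ g -> summ h -> rsum (fun i => g i - h i) = ssum g - ssum h.
Proof.
move=> g0 h0 sg sh.
have e : (\esum_(i in [set: T]) (EFin \o (fun i => g i - h i)%R)^\+ i
        - \esum_(i in [set: T]) (EFin \o (fun i => g i - h i)%R)^\- i =
        E g - E h)%E.
  by apply: (esumB sg sh) => i _; rewrite lee_fin.
by rewrite /rsum e !ssumE.
Qed.

Let pos f i := Num.max (f i) 0.
Let neg f i := Num.max (- f i) 0.

Let posneg f i : f i = pos f i - neg f i.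
Proof.
rewrite /pos /neg; case: (lerP 0 (f i)) => f0.
  by rewrite (max_idPr _) ?subr0// oppr_le0.
by rewrite (max_idPl _) ?opprK ?add0r// oppr_ge0 ltW.
Qed.
Let pos0 f i : 0 <= pos f i. Proof. by rewrite /pos le_max lexx orbT. Qed.
Let neg0 f i : 0 <= neg f i. Proof. by rewrite /neg le_max lexx orbT. Qed.
Let summ_pos f : summ f -> summ (pos f).
Proof.
rewrite /summable; apply: le_lt_trans; apply: le_esum => i _ /=.
by rewrite lee_fin ger0_norm// /pos ge_max normr_ge0 ler_norm.
Qed.
Let summ_neg f : summ f -> summ (neg f).
Proof.
rewrite /summable; apply: le_lt_trans; apply: le_esum => i _ /=.
by rewrite lee_fin ger0_norm// /neg ge_max normr_ge0 -normrN ler_norm.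
Qed.

Lemma rsum_split f : summ f ->
  exists g h, [/\ (forall i, 0 <= g i), (forall i, 0 <= h i), summ g, summ h &
    (forall i, f i = g i - h i) /\ (forall i, g i <= `|f i| /\ h i <= `|f i|)].
Proof.
move=> sf; exists (pos f), (neg f); split => //; [exact: summ_pos|exact: summ_neg|].
split=> // i; split.
  by rewrite /pos ge_max normr_ge0 ler_norm.
by rewrite /neg ge_max normr_ge0 -normrN ler_norm.
Qed.

Lemma eq_rsum f g : f =1 g -> rsum f = rsum g.
Proof. by move=> /funext ->. Qed.

Lemma summ0 : summ (fun _ : T => 0 : R).
Proof.
suff e : esum [set: T] (fun=> `|(0:R)%:E|%E) = 0 :> \bar R.
  by apply/(le_lt_trans _ (ltry 0)); rewrite e.
by apply: esum1 => i _; rewrite abse0.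
Qed.

Lemma ssum0 : ssum (fun _ : T => 0 : R) = 0.
Proof.
suff e : esum [set: T] (fun=> (0:R)%:E) = 0 :> \bar R by rewrite /ssum e.
exact: esum1.
Qed.

Lemma rsum_pos g : (forall i, 0 <= g i) -> summ g -> rsum g = ssum g.
Proof.
move=> g0 sg; rewrite -[RHS]subr0 -ssum0 -rsum_posB//; last exact: summ0.
by apply: eq_rsum => i; rewrite subr0.
Qed.

Lemma rsumD f g : summ f -> summ g ->
  rsum (fun i => f i + g i) = rsum f + rsum g.
Proof.
move=> /rsum_split[f1 [f2 [f10 f20 sf1 sf2 [fE _]]]].
move=> /rsum_split[g1 [g2 [g10 g20 sg1 sg2 [gE _]]]].
rewrite (eq_rsum fE) (eq_rsum gE) !rsum_posB// addrACA -opprD -!ssumD//.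
rewrite -rsum_posB.
- by apply: eq_rsum => i; rewrite fE gE addrACA opprD.
- by move=> i; rewrite addr_ge0.
- by move=> i; rewrite addr_ge0.
- exact: summD.
- exact: summD.
Qed.

Lemma rsumN f : summ f -> rsum (fun i => - f i) = - rsum f.
Proof.
move=> sf; have := rsumD sf (summN sf).
rewrite (@eq_rsum (fun i => f i - f i) (fun=> 0)); last by move=> i; rewrite subrr.
rewrite {1}rsum_pos//; last exact: summ0.
by rewrite ssum0 => /esym/eqP; rewrite addrC addr_eq0 => /eqP.
Qed.

Lemma rsumB f g : summ f -> summ g ->
  rsum (fun i => f i - g i) = rsum f - rsum g.
Proof. by move=> sf sg; rewrite rsumD ?rsumN//; apply: summN. Qed.

Let Ele c g : 0 <= c -> (forall i, 0 <= g i) ->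
  (E (fun i => (c * g i)%R) <= c%:E * E g)%E.
Proof.
move=> c0 g0; apply: ge_ereal_sup => _ [X [finX XI]] <-.
under eq_fsbigr do rewrite EFinM.
rewrite -ge0_mule_fsumr; last by move=> i; rewrite lee_fin.
by apply: lee_pmul => //; [rewrite fsume_ge0// => i _; rewrite lee_fin
 | apply: ereal_sup_ubound; exists X].
Qed.

Lemma summZ c g : summ g -> summ (fun i => c * g i).
Proof.
move=> sg; rewrite /summable; under eq_esum do rewrite /= normrM.
have := Ele (normr_ge0 c) (fun i => normr_ge0 (g i)).
move=> /le_lt_trans; apply; rewrite /summable in sg.
have : (\esum_(i in setT) `|g i|%:E)%E \is a fin_num.
  by rewrite ge0_fin_numE//; apply: esum_ge0 => i _; rewrite lee_fin.
by move=> /fineK <-; rewrite -EFinM ltry.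
Qed.

Lemma ssumZ c g : 0 <= c -> (forall i, 0 <= g i) -> summ g ->
  ssum (fun i => c * g i) = c * ssum g.
Proof.
move=> c0 g0 sg.
have cg0 i : 0 <= c * g i by rewrite mulr_ge0.
have le d h : 0 <= d -> (forall i, 0 <= h i) -> summ h ->
    ssum (fun i => d * h i) <= d * ssum h.
  move=> d0 h0 sh; rewrite -lee_fin EFinM -!ssumE//; last exact: summZ.
    exact: Ele.
  by move=> i; rewrite mulr_ge0.
apply/eqP; rewrite eq_le le//=.
have [->|cn0] := eqVneq c 0.
  by rewrite mul0r ssum_ge0// => i; rewrite mul0r.
have cp : 0 < c by rewrite lt_def cn0.
rewrite -ler_pdivlMl//; apply: le_trans (le c^-1 _ _ _ _) => //.
- by rewrite (_ : (fun i => _) = g)//; apply/funext => i; rewrite mulKf.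
- by rewrite invr_ge0.
- exact: summZ.
Qed.

Lemma rsumZ c f : summ f -> rsum (fun i => c * f i) = c * rsum f.
Proof.
move=> sf; wlog c0 : c / 0 <= c => [hw|].
  have [|/ltW c0] := leP 0 c; first exact: hw.
  rewrite -[c in RHS]opprK mulNr -hw ?oppr_ge0// -rsumN; last exact: summZ.
  by apply: eq_rsum => i; rewrite mulNr opprK.
have [g [h [g0 h0 sg sh [fE _]]]] := rsum_split sf.
rewrite (eq_rsum fE) rsum_posB// mulrBr -!ssumZ// -rsum_posB.
- by apply: eq_rsum => i; rewrite fE mulrBr.
- by move=> i; rewrite mulr_ge0.
- by move=> i; rewrite mulr_ge0.
- exact: summZ.
- exact: summZ.
Qed.

Lemma ler_rsum_ssum f g : (forall i, `|f i| <= g i) -> summ g ->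
  rsum f <= ssum g.
Proof.
move=> fg sg; have sf := summ_le fg sg.
have g0 i : 0 <= g i by apply: le_trans (fg i).
rewrite -subr_ge0 -(rsum_pos g0 sg) -rsumB// rsum_pos.
- by apply: ssum_ge0 => i; rewrite subr_ge0 (le_trans (ler_norm _) (fg i)).
- by move=> i; rewrite subr_ge0 (le_trans (ler_norm _) (fg i)).
- exact: summB.
Qed.

End Real.

Lemma reindex_ssum (T T' : choiceType) (e : T -> T') (g : T' -> R) :
  bijective e -> ssum g = ssum (g \o e).
Proof.
move=> be; rewrite /ssum (@reindex_esum _ _ _ setT setT e)//.
by rewrite setTT_bijective.
Qed.

Lemma reindex_summ (T T' : choiceType) (e : T -> T') (g : T' -> R) :
  bijective e -> summ g -> summ (g \o e).
Proof.
by move=> be; rewrite /summable (@reindex_esum _ _ _ setT setT e)// setTT_bijective.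
Qed.

Lemma reindex_rsum (T T' : choiceType) (e : T -> T') (f : T' -> R) :
  bijective e -> rsum f = rsum (f \o e).
Proof.
move=> be; have s : set_bij setT setT e by rewrite setTT_bijective.
rewrite /rsum !(reindex_esum _ _ _ _ s).
by congr (fine (_ - _)%E); apply: eq_esum => i _; rewrite ?funeposE ?funenegE.
Qed.

Section Fubini.
Variables T1 T2 : choiceType.
Implicit Types g h : T1 -> T2 -> R.
Local Notation EE g := (\esum_(i in setT) \esum_(j in setT) (g i j)%:E)%E.

Lemma esum_swap (g : T1 -> T2 -> \bar R) : (forall i j, 0 <= g i j)%E ->
  (\esum_(i in setT) \esum_(j in setT) g i j =
   \esum_(j in setT) \esum_(i in setT) g i j)%E.
Proof.
move=> g0; rewrite !esum_esum//.
rewrite (@reindex_esum _ _ _ setT (setT `*`` (fun=> setT)) (fun p : T1 * T2 => (p.2, p.1))).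
  by rewrite (_ : _ `*`` _ = setT)//; apply/seteqP; split.
split=> //; first by move=> [a b] [c d] _ _ [-> ->].
by move=> [a b] _; exists (b, a).
Qed.

Definition summ2 g := (EE (fun i j => `|g i j|%R) < +oo)%E.

Lemma summ2_slice g i : summ2 g -> summ (g i).
Proof.
move=> sg; apply: le_lt_trans sg; rewrite (esumID [set i])//; last first.
  by move=> k _; apply: esum_ge0 => j _; rewrite lee_fin.
rewrite setTI esum_set1; last by apply: esum_ge0 => j _; rewrite lee_fin.
rewrite leeDl//; apply: esum_ge0 => k _.
by apply: esum_ge0 => j _; rewrite lee_fin.
Qed.

Lemma summ2_outer g : summ2 g -> summ (fun i => ssum (fun j => `|g i j|)).
Proof.
move=> sg; rewrite /summable.
under eq_esum => i _.
  rewrite gee0_abs; last by rewrite lee_fin ssum_ge0.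
  rewrite -ssumE//; last exact: (summ_norm (summ2_slice i sg)).
  over.
exact: sg.
Qed.

Lemma summ2_le g h : (forall i j, `|g i j| <= `|h i j|) -> summ2 h -> summ2 g.
Proof.
move=> gh; apply: le_lt_trans; apply: le_esum => i _; apply: le_esum => j _.
by rewrite lee_fin.
Qed.

End Fubini.

Lemma summ2_swap (T1 T2 : choiceType) (g : T1 -> T2 -> R) : summ2 g -> summ2 (fun j i => g i j).
Proof. by rewrite /summ2 esum_swap// => i j; rewrite lee_fin. Qed.

Lemma ssum_swap (T1 T2 : choiceType) (g : T1 -> T2 -> R) : (forall i j, 0 <= g i j) -> summ2 g ->
  ssum (fun i => ssum (g i)) = ssum (fun j => ssum (g^~ j)).
Proof.
move=> g0 sg.
have sg' : summ2 (fun j i => g i j) by apply: summ2_swap.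
have norm i j : `|g i j| = g i j by rewrite ger0_norm.
apply: EFin_inj; rewrite -!ssumE.
- under eq_esum => i _ do rewrite -ssumE ?(summ2_slice _ sg)//.
  under [RHS]eq_esum => i _ do rewrite -ssumE ?(summ2_slice _ sg')//.
  by apply: esum_swap => i j; rewrite lee_fin.
- by move=> i; exact: ssum_ge0.
- apply: eq_summ (summ2_outer sg') => i.
  by congr ssum; apply/funext => j; rewrite norm.
- by move=> i; exact: ssum_ge0.
- apply: eq_summ (summ2_outer sg) => i.
  by congr ssum; apply/funext => j; rewrite norm.
Qed.

Lemma summ_rsum (T1 T2 : choiceType) (g : T1 -> T2 -> R) : summ2 g -> summ (fun i => rsum (g i)).
Proof.
move=> sg; apply: summ_le (summ2_outer sg) => i.
have sgi := summ2_slice i sg.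
have sni := summ_norm sgi.
rewrite ler_norml lerNl; apply/andP; split; last exact: ler_rsum_ssum.
by rewrite -rsumN//; apply: ler_rsum_ssum => // j; rewrite normrN.
Qed.

Lemma rsum_swap (T1 T2 : choiceType) (f : T1 -> T2 -> R) : summ2 f ->
  rsum (fun i => rsum (f i)) = rsum (fun j => rsum (f^~ j)).
Proof.
move=> sf.
pose g i j := Num.max (f i j) 0; pose h i j := Num.max (- f i j) 0.
have g0 i j : 0 <= g i j by rewrite le_max lexx orbT.
have h0 i j : 0 <= h i j by rewrite le_max lexx orbT.
have fE i j : f i j = g i j - h i j.
  rewrite /g /h; case: (lerP 0 (f i j)) => f0.
    by rewrite (max_idPr _) ?subr0// oppr_le0.
  by rewrite (max_idPl _) ?opprK ?add0r// oppr_ge0 ltW.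
have sg : summ2 g.
  apply: summ2_le sf => i j; rewrite ger0_norm// ge_max normr_ge0.
  by rewrite ler_norm.
have sh : summ2 h.
  apply: summ2_le sf => i j; rewrite ger0_norm// ge_max normr_ge0.
  by rewrite -normrN ler_norm.
have sg' := summ2_swap sg; have sh' := summ2_swap sh.
have main (A B : choiceType) (u v : A -> B -> R) : (forall i j, 0 <= u i j) ->
   (forall i j, 0 <= v i j) -> summ2 u -> summ2 v ->
   rsum (fun i => rsum (fun j => u i j - v i j)) =
   ssum (fun i => ssum (u i)) - ssum (fun i => ssum (v i)).
  move=> u0 v0 su sv.
  have o (w : A -> B -> R) : (forall i j, 0 <= w i j) -> summ2 w ->
      summ (fun i => ssum (w i)).
    move=> w0 sw; apply: eq_summ (summ2_outer sw) => i.
    congr ssum; apply/funext => j.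
    by rewrite ger0_norm.
  under eq_rsum => i do rewrite rsum_posB ?(summ2_slice _ su) ?(summ2_slice _ sv)//.
  by rewrite rsum_posB//; do ?[by move=> i; exact: ssum_ge0]; exact: o.
under eq_rsum => i do under eq_rsum => j do rewrite fE.
under [RHS]eq_rsum => i do under eq_rsum => j do rewrite fE.
rewrite main// (main _ _ (fun j i => g i j) (fun j i => h i j))//.
by rewrite ssum_swap// (@ssum_swap _ _ h).
Qed.

End Sums.

Section ComplexSums.
Variable R : realType.
Local Notation summ g := (summable setT (fun i => (g i)%:E)).

Section One.
Variable T : choiceType.
Implicit Types f g : T -> R[i].

Lemma csummable_Re f : csummable f -> summ (fun i => complex.Re (f i)).
Proof. by apply: summ_le => i; apply: ler_Re_rnorm. Qed.

Lemma csummable_Im f : csummable f -> summ (fun i => complex.Im (f i)).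
Proof. by apply: summ_le => i; apply: ler_Im_rnorm. Qed.

Lemma csummable_le (V : semiNormedZmodType R[i]) (f : T -> V) (g : T -> R) :
  (forall i, rnorm (f i) <= g i) -> summ g -> csummable f.
Proof. by move=> fg; apply: summ_le => i; rewrite ger0_norm ?rnorm_ge0. Qed.

Lemma csummable0 (V : semiNormedZmodType R[i]) : csummable (fun _ : T => 0 : V).
Proof. by apply: eq_summ (@summ0 _ _) => i; rewrite rnorm0. Qed.

Lemma csummableD (V : semiNormedZmodType R[i]) (f g : T -> V) :
  csummable f -> csummable g -> csummable (fun i => f i + g i).
Proof.
by move=> sf sg; apply: csummable_le (summD sf sg) => i; apply: rnormD.
Qed.

Lemma csummableN (V : semiNormedZmodType R[i]) (f : T -> V) :
  csummable f -> csummable (fun i => - f i).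
Proof. by apply: eq_summ => i; rewrite rnormN. Qed.

Lemma csummableZ c f : csummable f -> csummable (fun i => c * f i).
Proof. by move=> /(summZ (rnorm c)); apply: eq_summ => i; rewrite rnormM. Qed.

Lemma eq_csum f g : f =1 g -> csum f = csum g.
Proof. by move=> /funext ->. Qed.

Lemma csumD f g : csummable f -> csummable g ->
  csum (fun i => f i + g i) = csum f + csum g.
Proof.
move=> sf sg; rewrite /csum.
rewrite -[RHS]/(Complex (_ + _) (_ + _)); congr Complex.
  rewrite -rsumD; [|exact: csummable_Re..].
  by apply: eq_rsum => i; case: (f i) => ? ?; case: (g i).
rewrite -rsumD; [|exact: csummable_Im..].
by apply: eq_rsum => i; case: (f i) => ? ?; case: (g i).
Qed.

Lemma csumZ c f : csummable f -> csum (fun i => c * f i) = c * csum f.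
Proof.
move=> sf; have sr := csummable_Re sf; have si := csummable_Im sf.
rewrite /csum; case: c => a b.
rewrite -[RHS]/(Complex (_ - _) (_ + _)); congr Complex.
  rewrite -!rsumZ// -rsumB; [|exact: summZ..].
  by apply: eq_rsum => i; case: (f i).
rewrite -!rsumZ// -rsumD; [|exact: summZ..].
by apply: eq_rsum => i; case: (f i).
Qed.

Lemma csumN f : csummable f -> csum (fun i => - f i) = - csum f.
Proof.
by move=> sf; rewrite -mulN1r -csumZ//; apply: eq_csum => i; rewrite mulN1r.
Qed.

Lemma rnorm_csum f : csummable f ->
  rnorm (csum f) <= ssum (fun i => rnorm (f i)).
Proof.
move=> sf; have [->|n0] := eqVneq (csum f) 0.
  by rewrite rnorm0 ssum_ge0// => i; apply: rnorm_ge0.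
have nn0 : `|csum f| != 0 by rewrite normr_eq0.
pose u : R[i] := `|csum f| / csum f.
have u1 : rnorm u = 1.
  by apply: complexI; rewrite -rnormE /u normrM normrV ?unitfE// normr_id mulfV.
have uE : (rnorm (csum f))%:C = csum (fun i => u * f i).
  by rewrite csumZ// /u divfK// -rnormE.
have -> : rnorm (csum f) = rsum (fun i => complex.Re (u * f i)).
  by have := congr1 (@complex.Re _) uE.
apply: ler_rsum_ssum => // i.
by rewrite (le_trans (ler_Re_rnorm _))// rnormM u1 mul1r.
Qed.

Lemma csum_single f a : (forall i, i != a -> f i = 0) -> csum f = f a.
Proof.
have key (h : T -> R) : (forall i, i != a -> h i = 0) -> rsum h = h a.
  move=> h0; rewrite /rsum.
  have e (g : T -> \bar R) : (forall i, 0 <= g i)%E ->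
      (forall i, i != a -> g i = 0%E) -> (\esum_(i in setT) g i = g a)%E.
    move=> g0 ga; rewrite (esumID [set a])// setTI esum_set1// setTI esum1 ?adde0//.
    by move=> i /= /eqP; exact: ga.
  rewrite !e//.
  - by have /= <- := congr1 (@^~ a) (funeposneg (EFin \o h)).
  - by move=> i /h0 hi; rewrite /= funenegE /= hi oppr0 maxxx.
  - by move=> i /h0 hi; rewrite /= funeposE /= hi maxxx.
move=> f0; rewrite /csum !key; first by case: (f a).
  by move=> i /f0 ->.
by move=> i /f0 ->.
Qed.

End One.

Lemma reindex_csum (T T' : choiceType) (e : T -> T') (f : T' -> R[i]) :
  bijective e -> csum f = csum (f \o e).
Proof. by move=> be; rewrite /csum !(reindex_rsum _ be). Qed.

Lemma reindex_csummable (T T' : choiceType) (e : T -> T') (f : T' -> R[i]) :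
  bijective e -> csummable f -> csummable (f \o e).
Proof. by move=> be; apply: reindex_summ. Qed.

Definition csummable2 (T1 T2 : choiceType) (f : T1 -> T2 -> R[i]) :=
  summ2 (fun i j => rnorm (f i j)).

Lemma csum_swap (T1 T2 : choiceType) (f : T1 -> T2 -> R[i]) : csummable2 f ->
  csum (fun i => csum (f i)) = csum (fun j => csum (f^~ j)).
Proof.
move=> sf; rewrite /csum /= rsum_swap; last first.
  by apply: summ2_le sf => i j; rewrite (ger0_norm (rnorm_ge0 _)) ler_Re_rnorm.
rewrite (rsum_swap (f := fun i j => complex.Im (f i j)))//.
by apply: summ2_le sf => i j; rewrite (ger0_norm (rnorm_ge0 _)) ler_Im_rnorm.
Qed.

Lemma csummable2_le (T1 T2 : choiceType) (f g : T1 -> T2 -> R[i]) :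
  (forall i j, rnorm (f i j) <= rnorm (g i j)) -> csummable2 g -> csummable2 f.
Proof.
by move=> fg; apply: summ2_le => i j; rewrite !ger0_norm ?rnorm_ge0.
Qed.

Lemma csummable2_swap (T1 T2 : choiceType) (f : T1 -> T2 -> R[i]) :
  csummable2 f -> csummable2 (fun j i => f i j).
Proof. by move=> /summ2_swap. Qed.

Lemma csummable2_slice (T1 T2 : choiceType) (f : T1 -> T2 -> R[i]) i :
  csummable2 f -> csummable (f i).
Proof. by move=> /(summ2_slice i). Qed.

Lemma csummable2_outer (T1 T2 : choiceType) (f : T1 -> T2 -> R[i]) :
  csummable2 f -> summ (fun i => ssum (fun j => rnorm (f i j))).
Proof.
move=> /summ2_outer; apply: eq_summ => i; congr ssum; apply/funext => j.
by rewrite ger0_norm ?rnorm_ge0.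
Qed.

Lemma csummable_csum (T1 T2 : choiceType) (f : T1 -> T2 -> R[i]) :
  csummable2 f -> csummable (fun i => csum (f i)).
Proof.
move=> sf; apply: csummable_le (csummable2_outer sf) => i.
exact: rnorm_csum (csummable2_slice i sf).
Qed.

Lemma ssum_csum (T1 T2 : choiceType) (f : T1 -> T2 -> R[i]) : csummable2 f ->
  ssum (fun j => rnorm (csum (f^~ j))) <=
  ssum (fun i => ssum (fun j => rnorm (f i j))).
Proof.
move=> sf; have sf' := csummable2_swap sf.
rewrite ssum_swap//; last by move=> i j; apply: rnorm_ge0.
apply: le_ssum; last exact: csummable2_outer.
by move=> j; rewrite rnorm_ge0/= rnorm_csum//; exact: (csummable2_slice j sf').
Qed.

Lemma csummable2I (T1 T2 : choiceType) (f : T1 -> T2 -> R[i]) (g : T1 -> R) :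
  (forall i, csummable (f i)) ->
  (forall i, ssum (fun j => rnorm (f i j)) <= g i) -> summ g ->
  csummable2 f.
Proof.
move=> sf fg sg; have g0 i : 0 <= g i.
  by apply: le_trans (fg i); apply: ssum_ge0 => j; apply: rnorm_ge0.
apply: le_lt_trans ((summE g0).1 sg).
apply: le_esum => i _.
under eq_esum do rewrite (ger0_norm (rnorm_ge0 _)).
by rewrite ssumE ?lee_fin//; [move=> j; apply: rnorm_ge0 | exact: sf].
Qed.

Lemma ler_ssum (T : choiceType) (g : T -> R) i :
  (forall j, 0 <= g j) -> summ g -> g i <= ssum g.
Proof.
move=> g0 sg; rewrite -lee_fin -ssumE// (esumID [set i])//; last first.
  by move=> j _; rewrite lee_fin.
rewrite setTI esum_set1 ?lee_fin// leeDl//.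
by apply: esum_ge0 => j _; rewrite lee_fin.
Qed.

Lemma csum_recl (f : nat -> R[i]) : csummable f ->
  csum f = f 0%N + csum (fun n => f n.+1).
Proof.
have E (a : nat -> \bar R) : (forall n, 0 <= a n)%E ->
   (\esum_(i in setT) a i = a 0%N + \esum_(i in setT) a i.+1)%E.
  move=> a0; rewrite (esumID [set 0%N])// setTI esum_set1//; congr (_ + _)%E.
  rewrite setTI -(@esum_image _ _ _ setT S a); last by move=> ? ? _ _ [].
  congr esum; apply/seteqP; split=> [[|n] //= _|_ [n _ <-]//].
  by exists n.
have key (h : nat -> R) : summ h -> rsum h = h 0%N + rsum (fun n => h n.+1).
  move=> /rsum_split[u [v [u0 v0 su sv [hE _]]]].
  have shift (w : nat -> R) : (forall n, 0 <= w n) -> summ w ->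
      summ (fun n => w n.+1) /\ ssum w = w 0%N + ssum (fun n => w n.+1).
    move=> w0 sw; have /= Ew : (\esum_(i in setT) (EFin \o w) i =
        (EFin \o w) 0%N + \esum_(i in setT) (EFin \o w) i.+1)%E.
      by apply: E => n; rewrite lee_fin.
    have sw' : summ (fun n => w n.+1).
      apply/summE => //; apply: le_lt_trans ((summE w0).1 sw).
      by rewrite Ew leeDr ?lee_fin.
    by split=> //; apply: EFin_inj; rewrite EFinD -!ssumE.
  have [su' ue] := shift _ u0 su; have [sv' ve] := shift _ v0 sv.
  rewrite (eq_rsum hE) (eq_rsum (fun n => hE n.+1)) !rsum_posB//.
  by rewrite ue ve hE opprD addrACA.
move=> sf; rewrite /csum (key _ (csummable_Re sf)) (key _ (csummable_Im sf)).
by case: (f 0%N).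
Qed.

End ComplexSums.

(* Unital Banach algebras. This is a plain record rather than an HB structure
   because HB accepts no join of rings and [normedZmodType]s other than
   [numDomainType]; the operations are then made available on the carrier through
   [ban_sort]. The norm of [1] is not required to be [1]. *)
Record banachAlgebra (K : numFieldType) := BanachAlgebra {
  ban_space : completeNormedModType K;
  ban_one : ban_space;
  ban_mul : ban_space -> ban_space -> ban_space;
  ban_mulA : associative ban_mul;
  ban_mul1 : left_id ban_one ban_mul;
  ban_mulr1 : right_id ban_one ban_mul;
  ban_mulDl : left_distributive ban_mul +%R;
  ban_mulDr : right_distributive ban_mul +%R;
  ban_one_neq0 : ban_one != 0;
  ban_scaleAl : forall (c : K) x y, c *: ban_mul x y = ban_mul (c *: x) y;
  ban_scaleAr : forall (c : K) x y, c *: ban_mul x y = ban_mul x (c *: y);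
  ban_normM : forall x y, `|ban_mul x y| <= `|x| * `|y|
}.

Definition ban_sort (K : numFieldType) (A : banachAlgebra K) : Type :=
  ban_space A.
Coercion ban_sort : banachAlgebra >-> Sortclass.

HB.instance Definition _ (K : numFieldType) (A : banachAlgebra K) :=
  CompleteNormedModule.copy (ban_sort A) (ban_space A).
HB.instance Definition _ (K : numFieldType) (A : banachAlgebra K) :=
  GRing.Zmodule_isNzRing.Build (ban_sort A) (@ban_mulA K A) (@ban_mul1 K A)
    (@ban_mulr1 K A) (@ban_mulDl K A) (@ban_mulDr K A) (@ban_one_neq0 K A).
HB.instance Definition _ (K : numFieldType) (A : banachAlgebra K) :=
  GRing.Lmodule_isLalgebra.Build K (ban_sort A) (@ban_scaleAl K A).
HB.instance Definition _ (K : numFieldType) (A : banachAlgebra K) :=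
  GRing.Lalgebra_isAlgebra.Build K (ban_sort A) (@ban_scaleAr K A).

Lemma ler_normM (K : numFieldType) (A : banachAlgebra K) (x y : A) :
  `|x * y| <= `|x| * `|y|.
Proof. exact: ban_normM. Qed.

Definition invertible (A : nzRingType) (a : A) : Prop :=
  exists b : A, a * b = 1 /\ b * a = 1.

Definition stable_rank_one (K : numFieldType) (A : banachAlgebra K) : Prop :=
  dense [set a : A | invertible a].

Section FastSequences.
Variable R : realType.

(* Completeness is proved below through sequences whose consecutive terms are at
   distance at most 1/2, 1/4, 1/8, ... *)
Definition rate (n : nat) : R := 1 / (2 ^ n.+1)%:R.

Lemma rate_gt0 n : 0 < rate n.
Proof. by rewrite divr_gt0// ltr0n expn_gt0. Qed.

Lemma rateS n : rate n = 2 * rate n.+1.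
Proof.
rewrite /rate [in RHS]expnS natrM !div1r invfM mulrA divff ?mul1r// ?pnatr_eq0.
Qed.

Lemma rate_small (e : R) : 0 < e -> exists n, 2 * rate n < e.
Proof.
move=> e0; exists (Num.bound e^-1).
have ei : 0 <= e^-1 by rewrite invr_ge0 ltW.
rewrite /rate expnS natrM div1r invfM mulrA divff ?pnatr_eq0// mul1r.
rewrite -[ltRHS]invrK ltf_pV2 ?posrE ?invr_gt0// ?ltr0n ?expn_gt0//.
by apply: (lt_trans (archi_boundP ei)); rewrite ltr_nat ltn_expl.
Qed.

Definition fast (V : normedModType R[i]) (u : nat -> V) :=
  forall n, rnorm (u n.+1 - u n) <= rate n.

Definition fast_limit (V : normedModType R[i]) (u : nat -> V) (l : V) :=
  forall n, rnorm (l - u n) <= 2 * rate n.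

Lemma fast_dist (V : normedModType R[i]) (u : nat -> V) n m : fast u ->
  rnorm (u (n + m)%N - u n) <= 2 * rate n.
Proof.
move=> fu; apply: (@le_trans _ _ (2 * rate n - 2 * rate (n + m)%N)).
  elim: m => [|m IH]; first by rewrite addn0 !subrr rnorm0.
  rewrite addnS -(subrK (u (n + m)%N) (u (n + m).+1)) -addrA.
  apply: le_trans (rnormD _ _) _; rewrite -rateS.
  apply: le_trans (lerD (fu _) IH) _.
  by lra.
by rewrite gerBl mulr_ge0// ltW ?rate_gt0.
Qed.

Lemma ball_rnormE (V : normedModType R[i]) (x y : V) (e : R) :
  ball x e%:C y = (rnorm (x - y) < e).
Proof. by rewrite -ball_normE /= rnormE ltcR. Qed.

Lemma posC_real (e : R[i]) : 0 < e -> exists2 r : R, 0 < r & e = r%:C.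
Proof.
move=> e0; exists (complex.Re e); last by rewrite RRe_real// gtr0_real.
by move: e0; rewrite ltcE => /andP[].
Qed.

Lemma cvg_rnormP (V : normedModType R[i]) (F : set_system V) (l : V) :
  Filter F ->
  F --> l <-> forall e : R, 0 < e -> F [set y | rnorm (l - y) < e].
Proof.
move=> FF; split.
  move=> /cvgrPdist_lt Fl e e0; have e0' : 0 < e%:C by rewrite (ltcR 0 e).
  apply: filterS (Fl _ e0') => y /=.
  by rewrite rnormE ltcR.
move=> Fl; apply/cvgrPdist_lt => _ /posC_real[e e0 ->].
by apply: filterS (Fl _ e0) => y /=; rewrite rnormE ltcR.
Qed.

Lemma cauchy_fast (V : normedModType R[i]) :
  (forall u : nat -> V, fast u -> exists l, fast_limit u l) ->
  forall F : set_system V, ProperFilter F -> cauchy F -> cvg F.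
Proof.
move=> fastV F FF /cauchyP cF.
have /choice[u uP] n : exists x : V, F (ball x (rate n.+2)%:C).
  by apply: cF; rewrite (ltcR 0) rate_gt0.
have fu : fast u.
  move=> n; have := filter_ex (filterI (uP n) (uP n.+1)) => -[y []].
  rewrite !ball_rnormE => h1 h2.
  rewrite -(subrK y (u n.+1)) -addrA; apply: le_trans (rnormD _ _) _.
  rewrite (rnorm_distC y); apply: le_trans (lerD (ltW h2) (ltW h1)) _.
  have h : rate n.+3 <= rate n.+2.
    by rewrite (rateS n.+2) mulr_natl mulr2n lerDl ltW ?rate_gt0.
  apply: (le_trans (lerD h (lexx _))).
  by rewrite (rateS n) (rateS n.+1); have := rate_gt0 n.+2; lra.
have [l lP] := fastV u fu.
apply/cvg_ex; exists l; apply/cvg_rnormP => e e0.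
have [n ne] := rate_small (divr_gt0 e0 (ltr0n R 2)).
apply: filterS (uP n) => y; rewrite ball_rnormE /= => yn.
rewrite -(subrK (u n) l) -addrA; apply: le_lt_trans (rnormD _ _) _.
rewrite [ltRHS](splitr e) ltrD//; first exact: le_lt_trans (lP n) ne.
apply: lt_trans yn _; apply: le_lt_trans ne.
by rewrite (rateS n) (rateS n.+1); have := rate_gt0 n.+2; lra.
Qed.

Lemma fast_cvg (V : completeNormedModType R[i]) (u : nat -> V) :
  fast u -> exists l, fast_limit u l.
Proof.
move=> fu.
have : cvg (u @ \oo).
  apply: cauchy_cvg; apply/cauchyP => _ /posC_real[e e0 ->].
  have [n ne] := rate_small e0; exists (u n).
  exists n => // m /= nm; rewrite ball_rnormE rnorm_distC -(subnKC nm).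
  exact: le_lt_trans (fast_dist _ _ fu) ne.
move=> /cvg_ex[l ul]; exists l => n.
apply/ler_addgt0Pr => e e0.
have /cvg_rnormP /(_ _ e0) [N _ NP] := ul.
have := NP (maxn n N) (leq_maxr _ _) => /= /ltW h.
rewrite -(subrK (u (maxn n N)) l) -addrA addrC [leRHS]addrC.
rewrite addrC; apply: le_trans (rnormD _ _) _; apply: lerD => //.
by rewrite -(subnKC (leq_maxl n N)); apply: fast_dist.
Qed.

End FastSequences.
Arguments rate {R} n.

Section EllOne.
Variable R : realType.
Local Notation summ g := (summable setT (fun i => (g i)%:E)).

Lemma rateD N n : rate (N + n) = 2 * rate N / (2 ^ n.+1)%:R :> R.
Proof.
have e : 2 * (1 / (2 ^ N.+1)%:R) = (2 ^ N)%:R^-1 :> R.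
  by rewrite expnS natrM div1r invfM mulrA divff ?pnatr_eq0// mul1r.
by rewrite /rate -addnS expnD natrM e !div1r invfM.
Qed.

Lemma summ_rate N : summ (fun n => rate (N + n) : R).
Proof.
have r0 n : 0 <= rate (N + n) :> R by rewrite ltW ?rate_gt0.
apply/(summE r0); rewrite -nneseries_esumT//.
apply: (@le_lt_trans _ _ (2 * rate N : R)%:E); last exact: ltry.
have h : 0 <= 2 * rate N :> R by rewrite mulr_ge0 ?ltW ?rate_gt0.
apply: le_trans (epsilon_trick0 xpredT h); apply: lee_nneseries => [n _ _|n _]; first by rewrite lee_fin.
by rewrite lee_fin rateD.
Qed.

Lemma ssum_rate N : ssum (fun n => rate (N + n)) <= 2 * rate N :> R.
Proof.
have r0 n : 0 <= rate (N + n) :> R by rewrite ltW ?rate_gt0.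
rewrite -lee_fin -ssumE//; last exact: summ_rate.
rewrite -nneseries_esumT//.
have h : 0 <= 2 * rate N :> R by rewrite mulr_ge0 ?ltW ?rate_gt0.
apply: le_trans (epsilon_trick0 xpredT h); apply: lee_nneseries => [n _ _|n _]; first by rewrite lee_fin.
by rewrite lee_fin rateD.
Qed.

Record ell1Z := Ell1Z {
  ell1Z_fun :> int -> R[i];
  ell1Z_summable : `[< csummable ell1Z_fun >]
}.

HB.instance Definition _ := [isSub for ell1Z_fun].
HB.instance Definition _ := [Choice of ell1Z by <:].

Lemma ell1ZP (a : ell1Z) : csummable a.
Proof. exact/asboolP/ell1Z_summable. Qed.

Lemma ell1Z_ext (a b : ell1Z) : a =1 b -> a = b.
Proof. by move=> ab; apply: val_inj; apply/funext. Qed.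

Definition mk_ell1Z (a : int -> R[i]) (sa : csummable a) : ell1Z :=
  Ell1Z (introT (asboolP _) sa).

Definition ell1Z_zero := mk_ell1Z (@csummable0 R int R[i]).
Definition ell1Z_opp (a : ell1Z) := mk_ell1Z (csummableN (ell1ZP a)).
Definition ell1Z_add (a b : ell1Z) := mk_ell1Z (csummableD (ell1ZP a) (ell1ZP b)).
Definition ell1Z_scale (c : R[i]) (a : ell1Z) := mk_ell1Z (csummableZ c (ell1ZP a)).

Fact ell1Z_addA : associative ell1Z_add.
Proof. by move=> a b c; apply: ell1Z_ext => n /=; rewrite addrA. Qed.
Fact ell1Z_addC : commutative ell1Z_add.
Proof. by move=> a b; apply: ell1Z_ext => n /=; rewrite addrC. Qed.
Fact ell1Z_add0 : left_id ell1Z_zero ell1Z_add.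
Proof. by move=> a; apply: ell1Z_ext => n /=; rewrite add0r. Qed.
Fact ell1Z_addN : left_inverse ell1Z_zero ell1Z_opp ell1Z_add.
Proof. by move=> a; apply: ell1Z_ext => n /=; rewrite addNr. Qed.
HB.instance Definition _ :=
  GRing.isZmodule.Build ell1Z ell1Z_addA ell1Z_addC ell1Z_add0 ell1Z_addN.

Fact ell1Z_scaleA c d a : ell1Z_scale c (ell1Z_scale d a) = ell1Z_scale (c * d) a.
Proof. by apply: ell1Z_ext => n /=; rewrite mulrA. Qed.
Fact ell1Z_scale1 : left_id 1 ell1Z_scale.
Proof. by move=> a; apply: ell1Z_ext => n /=; rewrite mul1r. Qed.
Fact ell1Z_scaleDr : right_distributive ell1Z_scale +%R.
Proof. by move=> c a b; apply: ell1Z_ext => n /=; rewrite mulrDr. Qed.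
Fact ell1Z_scaleDl a : {morph ell1Z_scale^~ a : c d / c + d}.
Proof. by move=> c d; apply: ell1Z_ext => n /=; rewrite mulrDl. Qed.
HB.instance Definition _ :=
  GRing.Zmodule_isLmodule.Build R[i] ell1Z ell1Z_scaleA ell1Z_scale1
    ell1Z_scaleDr ell1Z_scaleDl.

Definition ell1Z_norm (a : ell1Z) : R[i] := (ssum (fun n => rnorm (a n)))%:C.

Fact ell1Z_normD a b : ell1Z_norm (a + b) <= ell1Z_norm a + ell1Z_norm b.
Proof.
rewrite /ell1Z_norm -rmorphD lecR /= -ssumD; [|by move=> n; exact: rnorm_ge0..
  |exact: ell1ZP|exact: ell1ZP].
apply: le_ssum => [n|]; first by rewrite rnorm_ge0 /= rnormD.
by apply: summD; exact: ell1ZP.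
Qed.
Fact ell1Z_normZ c a : ell1Z_norm (c *: a) = `|c| * ell1Z_norm a.
Proof.
rewrite /ell1Z_norm rnormE -rmorphM /= -ssumZ ?rnorm_ge0//; last exact: ell1ZP.
  by congr (ssum _)%:C; apply/funext => n; rewrite rnormM.
by move=> n; exact: rnorm_ge0.
Qed.
Fact ell1Z_norm0 a : ell1Z_norm a = 0 -> a = 0.
Proof.
move=> a0; apply: ell1Z_ext => n; apply: rnorm_eq0; apply/eqP.
rewrite eq_le rnorm_ge0 andbT.
have -> : 0 = ssum (fun n => rnorm (a n)) by have := congr1 (@complex.Re _) a0.
by apply: (ler_ssum (g := fun n => rnorm (a n))) (ell1ZP a) => j; exact: rnorm_ge0.
Qed.
HB.instance Definition _ :=
  Lmodule_isNormed.Build R[i] ell1Z ell1Z_normD ell1Z_normZ ell1Z_norm0.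

Lemma rnorm_ell1Z (a : ell1Z) : rnorm a = ssum (fun n => rnorm (a n)).
Proof. by []. Qed.

Lemma ell1Z_fast (u : nat -> ell1Z) : fast u -> exists l, fast_limit u l.
Proof.
move=> fu; pose d n k := u n.+1 k - u n k.
have sd N : csummable2 (fun n k => d (N + n)%N k).
  apply: (@csummable2I _ _ _ _ (fun n => rate (N + n))).
  - by move=> n; exact: (ell1ZP (u (N + n).+1 - u (N + n))).
  - by move=> n; apply: fu.
  - exact: summ_rate.
have sl : csummable (fun k => u 0%N k + csum (fun n => d n k)).
  apply: csummableD; first exact: ell1ZP.
  by apply: csummable_csum; apply: csummable2_swap; exact: (sd 0%N).
exists (mk_ell1Z sl) => N.
have lE k : mk_ell1Z sl k - u N k = csum (fun n => d (N + n)%N k).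
  elim: N => [|N IH] /=; first by rewrite addrC addKr.
  have := csummable2_slice k (csummable2_swap (sd N)).
  move=> /csum_recl; rewrite -IH /= addn0 => e.
  have -> : csum (fun n => d (N.+1 + n)%N k) = csum (fun n => d (N + n.+1)%N k).
    by apply: eq_csum => n; rewrite addSnnS.
  rewrite -[RHS](addKr (d N k)) -e /d /=.
  by rewrite opprB [RHS]addrC subrKA.
rewrite rnorm_ell1Z.
under [X in ssum X]eq_fun => k do rewrite -[_ k]/(mk_ell1Z sl k - u N k) lE.
apply: le_trans (ssum_csum (sd N)) _; apply: le_trans (ssum_rate N).
apply: le_ssum; last exact: summ_rate.
move=> n; rewrite ssum_ge0/=; last by move=> k; exact: rnorm_ge0.
exact: fu.
Qed.

HB.instance Definition _ :=
  Uniform_isComplete.Build ell1Z (cauchy_fast ell1Z_fast).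

Lemma subr_bij (n : int) : bijective (fun k : int => n - k).
Proof. by exists (fun k : int => n - k) => k; rewrite subKr. Qed.

Lemma sub_bij (n : int) : bijective (fun k : int => k - n).
Proof. by exists (fun k : int => k + n) => k; rewrite ?subrK ?addrK. Qed.

Lemma ssum_shift (b : ell1Z) k : ssum (fun n => rnorm (b (n - k))) = rnorm b.
Proof. exact/esym/(reindex_ssum (fun n => rnorm (b n)) (sub_bij k)). Qed.

Lemma csummable2_conv (a b : ell1Z) : csummable2 (fun k n => a k * b (n - k)).
Proof.
apply: (@csummable2I _ _ _ _ (fun k => rnorm b * rnorm (a k))).
- by move=> k; apply: csummableZ; exact: (reindex_csummable (sub_bij k) (ell1ZP b)).
- move=> k; rewrite -(ssum_shift b k) mulrC -ssumZ ?rnorm_ge0//.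
  + by under eq_fun do rewrite rnormM.
  + by move=> n; exact: rnorm_ge0.
  + exact: (reindex_csummable (sub_bij k) (ell1ZP b)).
- exact: summZ (ell1ZP a).
Qed.

Lemma csummable_conv (a b : ell1Z) n : csummable (fun k => a k * b (n - k)).
Proof. exact: (csummable2_slice n (csummable2_swap (csummable2_conv a b))). Qed.

Definition ell1Z_mul (a b : ell1Z) : ell1Z :=
  mk_ell1Z (csummable_csum (csummable2_swap (csummable2_conv a b))).

Lemma ell1Z_mulE a b n : ell1Z_mul a b n = csum (fun k => a k * b (n - k)).
Proof. by []. Qed.

Fact ell1Z_one_subproof : csummable (fun n : int => (n == 0)%:R : R[i]).
Proof.
have e := @esum_set1 R int 0 (fun=> 1%E) (@lee01 R).
apply: (@le_lt_trans _ _ 1%E) (ltry _); rewrite -[leRHS]e [leRHS]esum_mkcond.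
apply: le_esum => n _; rewrite in_set1 /=.
by case: (n == 0); rewrite ?rnorm1 ?rnorm0 lee_fin ?normr1 ?normr0.
Qed.

Definition ell1Z_one := mk_ell1Z ell1Z_one_subproof.

Fact ell1Z_mulC : commutative ell1Z_mul.
Proof.
move=> a b; apply: ell1Z_ext => n; rewrite !ell1Z_mulE.
rewrite (reindex_csum _ (subr_bij n)); apply: eq_csum => k /=.
by rewrite subKr mulrC.
Qed.

Fact ell1Z_mul1 : left_id ell1Z_one ell1Z_mul.
Proof.
move=> a; apply: ell1Z_ext => n; rewrite ell1Z_mulE (csum_single (a := 0)).
  by rewrite /= mul1r subr0.
by move=> k /negPf /= ->; rewrite mul0r.
Qed.

Fact ell1Z_mulr1 : right_id ell1Z_one ell1Z_mul.
Proof. by move=> a; rewrite ell1Z_mulC ell1Z_mul1. Qed.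

Fact ell1Z_mulDl : left_distributive ell1Z_mul +%R.
Proof.
move=> a b c; apply: ell1Z_ext => n /=; rewrite -csumD; [|exact: csummable_conv..].
by apply: eq_csum => k; rewrite mulrDl.
Qed.

Fact ell1Z_mulDr : right_distributive ell1Z_mul +%R.
Proof. by move=> a b c; rewrite !(ell1Z_mulC a) ell1Z_mulDl. Qed.

Fact ell1Z_scaleAl c a b : c *: ell1Z_mul a b = ell1Z_mul (c *: a) b.
Proof.
apply: ell1Z_ext => n /=; rewrite -csumZ; last exact: csummable_conv.
by apply: eq_csum => k; rewrite mulrA.
Qed.

Fact ell1Z_scaleAr c a b : c *: ell1Z_mul a b = ell1Z_mul a (c *: b).
Proof. by rewrite !(ell1Z_mulC a) ell1Z_scaleAl. Qed.

Fact ell1Z_mulA : associative ell1Z_mul.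
Proof.
move=> a b c; apply: ell1Z_ext => n; rewrite !ell1Z_mulE; apply/esym.
have sab k : csummable (fun j => a j * b (k - j)) by exact: csummable_conv.
have -> : csum (fun k => ell1Z_mul a b k * c (n - k)) =
    csum (fun k => csum (fun j => a j * b (k - j) * c (n - k))).
  apply: eq_csum => k; rewrite ell1Z_mulE mulrC -csumZ//.
  by apply: eq_csum => j; rewrite mulrC.
rewrite csum_swap; last first.
  apply: csummable2_swap.
  apply: csummable2_le (csummable2_conv a ((rnorm c)%:C *: b)) => j k /=.
  rewrite !rnormM rnorm_real ?rnorm_ge0// mulrCA mulrC ler_wpM2r//.
    by rewrite mulr_ge0 ?rnorm_ge0.
  rewrite rnorm_ell1Z; apply: (ler_ssum (g := fun n => rnorm (c n))) (ell1ZP c).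
  by move=> i; exact: rnorm_ge0.
apply: eq_csum => j; rewrite ell1Z_mulE -csumZ; last exact: csummable_conv.
rewrite [RHS](reindex_csum _ (sub_bij j)); apply: eq_csum => k /=.
by rewrite mulrA opprB subrKA.
Qed.

Fact ell1Z_one_neq0 : ell1Z_one != 0.
Proof.
apply/eqP => /(congr1 (fun a : ell1Z => a 0)) /= /eqP.
by rewrite oner_eq0.
Qed.

Fact ell1Z_normM (a b : ell1Z) : `|ell1Z_mul a b| <= `|a| * `|b|.
Proof.
rewrite !rnormE -rmorphM lecR /= rnorm_ell1Z.
apply: le_trans (ssum_csum (csummable2_conv a b)) _.
rewrite mulrC [rnorm a]rnorm_ell1Z -ssumZ ?rnorm_ge0//; last exact: ell1ZP.
  apply: le_ssum; last exact: summZ (ell1ZP a).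
  move=> k; rewrite ssum_ge0/=; last by move=> n; exact: rnorm_ge0.
  rewrite -(ssum_shift b k) mulrC -ssumZ ?rnorm_ge0//.
  + by under eq_fun do rewrite rnormM.
  + by move=> n; exact: rnorm_ge0.
  + exact: (reindex_csummable (sub_bij k) (ell1ZP b)).
by move=> k; exact: rnorm_ge0.
Qed.

Definition ell1Z_algebra : banachAlgebra R[i] :=
  BanachAlgebra ell1Z_mulA ell1Z_mul1 ell1Z_mulr1 ell1Z_mulDl ell1Z_mulDr
    ell1Z_one_neq0 ell1Z_scaleAl ell1Z_scaleAr ell1Z_normM.

End EllOne.

Section BanachNorm.
Variables (R : realType) (A : banachAlgebra R[i]).

Lemma ban_rnormM (x y : A) : rnorm (x * y) <= rnorm x * rnorm y.
Proof. by rewrite -lecR rmorphM /= -!rnormE ler_normM. Qed.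

Lemma rnorm_ban1_gt0 : 0 < rnorm (1 : A).
Proof.
rewrite lt_def rnorm_ge0 andbT; apply/eqP => /rnorm_eq0 /eqP.
by rewrite oner_eq0.
Qed.

End BanachNorm.

Lemma fast_limitI (R : realType) (V : normedModType R[i]) (u : nat -> V) l :
  fast u -> (forall e : R, 0 < e -> exists N, forall n, (N <= n)%N ->
    rnorm (l - u n) <= e) -> fast_limit u l.
Proof.
move=> fu lu n; apply/ler_addgt0Pr => e /lu [N NP].
have h := NP _ (leq_maxr n N).
rewrite -(subrK (u (maxn n N)) l) -addrA addrC [leRHS]addrC.
rewrite addrC; apply: le_trans (rnormD _ _) _; apply: lerD => //.
by rewrite -(subnKC (leq_maxl n N)); apply: fast_dist.
Qed.

Section Linfty.
Variables (R : realType) (A : banachAlgebra R[i]).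

Definition bounded_sequence (a : nat -> A) : Prop :=
  exists M : R, forall n, rnorm (a n) <= M.

Record linfty := Linfty {
  linfty_seq :> nat -> A;
  linfty_bounded : `[< bounded_sequence linfty_seq >]
}.

HB.instance Definition _ := [isSub for linfty_seq].
HB.instance Definition _ := [Choice of linfty by <:].

Lemma linftyP (a : linfty) : bounded_sequence a.
Proof. exact/asboolP/linfty_bounded. Qed.

Lemma linfty_ext (a b : linfty) : a =1 b -> a = b.
Proof. by move=> ab; apply: val_inj; apply/funext. Qed.

Definition mk_linfty (a : nat -> A) (ba : bounded_sequence a) : linfty :=
  Linfty (introT (asboolP _) ba).

Fact bounded_cst (x : A) : bounded_sequence (fun=> x).
Proof. by exists (rnorm x). Qed.
Fact boundedN (a : nat -> A) :
  bounded_sequence a -> bounded_sequence (fun n => - a n).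
Proof. by move=> [M aM]; exists M => n; rewrite rnormN. Qed.
Fact boundedD (a b : nat -> A) : bounded_sequence a -> bounded_sequence b ->
  bounded_sequence (fun n => a n + b n).
Proof.
move=> [M aM] [N bN]; exists (M + N) => n.
by rewrite (le_trans (rnormD _ _))// lerD.
Qed.
Fact boundedZ c (a : nat -> A) :
  bounded_sequence a -> bounded_sequence (fun n => c *: a n).
Proof.
by move=> [M aM]; exists (rnorm c * M) => n; rewrite rnormZ ler_wpM2l ?rnorm_ge0.
Qed.
Fact boundedM (a b : nat -> A) : bounded_sequence a -> bounded_sequence b ->
  bounded_sequence (fun n => a n * b n).
Proof.
move=> [M aM] [N bN]; exists (M * N) => n.
by rewrite (le_trans (ban_rnormM _ _))// ler_pM ?rnorm_ge0.
Qed.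

Definition linfty_zero := mk_linfty (bounded_cst 0).
Definition linfty_one := mk_linfty (bounded_cst 1).
Definition linfty_opp a := mk_linfty (boundedN (linftyP a)).
Definition linfty_add a b := mk_linfty (boundedD (linftyP a) (linftyP b)).
Definition linfty_mul a b := mk_linfty (boundedM (linftyP a) (linftyP b)).
Definition linfty_scale c a := mk_linfty (boundedZ c (linftyP a)).

Fact linfty_addA : associative linfty_add.
Proof. by move=> a b c; apply: linfty_ext => n /=; rewrite addrA. Qed.
Fact linfty_addC : commutative linfty_add.
Proof. by move=> a b; apply: linfty_ext => n /=; rewrite addrC. Qed.
Fact linfty_add0 : left_id linfty_zero linfty_add.
Proof. by move=> a; apply: linfty_ext => n /=; rewrite add0r. Qed.
Fact linfty_addN : left_inverse linfty_zero linfty_opp linfty_add.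
Proof. by move=> a; apply: linfty_ext => n /=; rewrite addNr. Qed.
HB.instance Definition _ :=
  GRing.isZmodule.Build linfty linfty_addA linfty_addC linfty_add0 linfty_addN.

Fact linfty_scaleA c d a : linfty_scale c (linfty_scale d a) = linfty_scale (c * d) a.
Proof. by apply: linfty_ext => n /=; rewrite scalerA. Qed.
Fact linfty_scale1 : left_id 1 linfty_scale.
Proof. by move=> a; apply: linfty_ext => n /=; rewrite scale1r. Qed.
Fact linfty_scaleDr : right_distributive linfty_scale +%R.
Proof. by move=> c a b; apply: linfty_ext => n /=; rewrite scalerDr. Qed.
Fact linfty_scaleDl a : {morph linfty_scale^~ a : c d / c + d}.
Proof. by move=> c d; apply: linfty_ext => n /=; rewrite scalerDl. Qed.
HB.instance Definition _ :=
  GRing.Zmodule_isLmodule.Build R[i] linfty linfty_scaleA linfty_scale1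
    linfty_scaleDr linfty_scaleDl.

Definition linfty_norm (a : linfty) : R[i] :=
  (sup (range (fun n => rnorm (a n))))%:C.

Let snorm (a : linfty) : R := sup (range (fun n => rnorm (a n))).

Let snorm_has_sup a : has_sup (range (fun n => rnorm (linfty_seq a n))).
Proof.
split; first by exists (rnorm (a 0%N)), 0%N.
by have [M aM] := linftyP a; exists M => _ [n _ <-].
Qed.

Let le_snorm (a : linfty) n : rnorm (a n) <= snorm a.
Proof. by apply: sup_upper_bound; [exact: snorm_has_sup | exists n]. Qed.

Let snorm_le (a : linfty) M : (forall n, rnorm (a n) <= M) -> snorm a <= M.
Proof.
move=> aM; apply: ge_sup; first by exists (rnorm (a 0%N)), 0%N.
by move=> _ [n _ <-].
Qed.

Let snorm_ge0 a : 0 <= snorm a.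
Proof. exact: le_trans (rnorm_ge0 _) (le_snorm a 0). Qed.

Fact linfty_normD a b : linfty_norm (a + b) <= linfty_norm a + linfty_norm b.
Proof.
rewrite /linfty_norm -rmorphD lecR; apply: (@snorm_le (a + b)) => n.
by rewrite (le_trans (rnormD _ _))// lerD ?le_snorm.
Qed.
Fact linfty_normZ c a : linfty_norm (c *: a) = `|c| * linfty_norm a.
Proof.
rewrite /linfty_norm rnormE -rmorphM /=; congr _%:C; apply/eqP.
change (snorm (c *: a) == rnorm c * snorm a).
have le d b : snorm (d *: b) <= rnorm d * snorm b.
  by apply: (@snorm_le (d *: b)) => n; rewrite rnormZ ler_wpM2l ?rnorm_ge0 ?le_snorm.
rewrite eq_le; apply/andP; split; first exact: le.
have [->|c0] := eqVneq c 0; first by rewrite rnorm0 mul0r.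
have cp : 0 < rnorm c.
  by rewrite lt_def rnorm_ge0 andbT; apply: contra_neq c0 => /rnorm_eq0.
rewrite -(ler_pM2l (x := rnorm c^-1)); last first.
  by rewrite -(pmulr_rgt0 _ cp) -rnormM divff// rnorm1.
rewrite mulrA -rnormM mulVf// rnorm1 mul1r.
by rewrite -[X in snorm X](scalerK c0) le.
Qed.
Fact linfty_norm0 a : linfty_norm a = 0 -> a = 0.
Proof.
move=> /(congr1 (@complex.Re _)) a0; apply: linfty_ext => n; apply: rnorm_eq0.
by apply/eqP; rewrite eq_le rnorm_ge0 andbT -[leRHS]a0 le_snorm.
Qed.
HB.instance Definition _ :=
  Lmodule_isNormed.Build R[i] linfty linfty_normD linfty_normZ linfty_norm0.

Lemma rnorm_linfty (a : linfty) : rnorm a = sup (range (fun n => rnorm (a n))).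
Proof. by []. Qed.

Lemma ler_rnorm_linfty (a : linfty) n : rnorm (a n) <= rnorm a.
Proof. exact: le_snorm. Qed.

Lemma rnorm_linfty_le (a : linfty) M : (forall n, rnorm (a n) <= M) -> rnorm a <= M.
Proof. exact: snorm_le. Qed.

Lemma linfty_fast (u : nat -> linfty) : fast u -> exists l, fast_limit u l.
Proof.
move=> fu; have /choice[l lP] k : exists l, fast_limit (u^~ k) l.
  apply: fast_cvg => n; apply: le_trans (fu n).
  exact: (ler_rnorm_linfty (u n.+1 - u n)).
have bl : bounded_sequence l.
  exists (2 * rate 0 + rnorm (u 0%N)) => k.
  rewrite -(subrK (u 0%N k) (l k)); apply: le_trans (rnormD _ _) _.
  by apply: lerD; [exact: lP | exact: ler_rnorm_linfty].
exists (mk_linfty bl) => n; apply: rnorm_linfty_le => k.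
exact: (lP k n).
Qed.

HB.instance Definition _ :=
  Uniform_isComplete.Build linfty (cauchy_fast linfty_fast).

Fact linfty_mulA : associative linfty_mul.
Proof. by move=> a b c; apply: linfty_ext => n /=; rewrite mulrA. Qed.
Fact linfty_mul1 : left_id linfty_one linfty_mul.
Proof. by move=> a; apply: linfty_ext => n /=; rewrite mul1r. Qed.
Fact linfty_mulr1 : right_id linfty_one linfty_mul.
Proof. by move=> a; apply: linfty_ext => n /=; rewrite mulr1. Qed.
Fact linfty_mulDl : left_distributive linfty_mul +%R.
Proof. by move=> a b c; apply: linfty_ext => n /=; rewrite mulrDl. Qed.
Fact linfty_mulDr : right_distributive linfty_mul +%R.
Proof. by move=> a b c; apply: linfty_ext => n /=; rewrite mulrDr. Qed.
Fact linfty_one_neq0 : linfty_one != 0.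
Proof.
apply/eqP => /(congr1 (fun a : linfty => a 0%N)) /= /eqP.
by rewrite oner_eq0.
Qed.
Fact linfty_scaleAl c a b : c *: linfty_mul a b = linfty_mul (c *: a) b.
Proof. by apply: linfty_ext => n /=; rewrite scalerAl. Qed.
Fact linfty_scaleAr c a b : c *: linfty_mul a b = linfty_mul a (c *: b).
Proof. by apply: linfty_ext => n /=; rewrite scalerAr. Qed.
Fact linfty_normM (a b : linfty) : `|linfty_mul a b| <= `|a| * `|b|.
Proof.
rewrite !rnormE -rmorphM lecR; apply: rnorm_linfty_le => n.
by rewrite (le_trans (ban_rnormM _ _))// ler_pM ?rnorm_ge0// ler_rnorm_linfty.
Qed.

Definition linfty_algebra : banachAlgebra R[i] :=
  BanachAlgebra linfty_mulA linfty_mul1 linfty_mulr1 linfty_mulDl linfty_mulDr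
    linfty_one_neq0 linfty_scaleAl linfty_scaleAr linfty_normM.

End Linfty.

(* Proper closed two-sided ideals: [idealr] is a proper left ideal. *)
Record closedIdeal (K : numFieldType) (A : banachAlgebra K) := ClosedIdeal {
  ideal_left :> idealr A;
  ideal_mulr : forall a, {in ideal_left, forall u, u * a \in ideal_left};
  ideal_closed : closed [set a : A | a \in ideal_left]
}.

Section QuotientAlgebra.
Variables (R : realType) (A : banachAlgebra R[i]) (I : closedIdeal A).
Implicit Types (a b : A).

Definition quotient : Type := {ideal_quot I}.
HB.instance Definition _ := GRing.Zmodule.copy quotient {ideal_quot I}.

Definition qpi (a : A) : quotient := \pi_{ideal_quot I}%qT a.

Lemma qpiP a b : qpi a = qpi b <-> a - b \in ideal_left I.
Proof.
by rewrite /qpi (@Quotient.idealrBE _ I); split => [->|/eqP].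
Qed.

Lemma qpiK (x : quotient) : qpi (repr (x : {ideal_quot I})) = x.
Proof. exact: reprK. Qed.

Lemma qpiD a b : qpi (a + b) = qpi a + qpi b.
Proof. exact: (pi_addr (s := {ideal_quot I})). Qed.
Lemma qpiN a : qpi (- a) = - qpi a.
Proof. exact: (pi_oppr (s := {ideal_quot I})). Qed.
Lemma qpi0 : qpi 0 = 0.
Proof. exact: (pi_zeror (s := {ideal_quot I})). Qed.
Lemma qpiB a b : qpi (a - b) = qpi a - qpi b.
Proof. by rewrite qpiD qpiN. Qed.

Let rp (x : quotient) : A := repr (x : {ideal_quot I}).
Let rpK x : qpi (rp x) = x. Proof. exact: qpiK. Qed.

Definition quotient_mul (x y : quotient) : quotient :=
  qpi (repr (x : {ideal_quot I}) * repr (y : {ideal_quot I})).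
Definition quotient_scale (c : R[i]) (x : quotient) : quotient :=
  qpi (c *: repr (x : {ideal_quot I})).

Lemma qpiM a b : quotient_mul (qpi a) (qpi b) = qpi (a * b).
Proof.
apply/qpiP; rewrite -/(rp _) -/(rp _).
have ha : rp (qpi a) - a \in ideal_left I by apply/qpiP; rewrite rpK.
have hb : rp (qpi b) - b \in ideal_left I by apply/qpiP; rewrite rpK.
have -> : rp (qpi a) * rp (qpi b) - a * b =
    rp (qpi a) * (rp (qpi b) - b) + (rp (qpi a) - a) * b.
  by rewrite mulrBr mulrBl addrA subrK.
by apply: rpredD; [exact: idealMr | exact: ideal_mulr].
Qed.

Lemma qpiZ c a : quotient_scale c (qpi a) = qpi (c *: a).
Proof.
apply/qpiP; rewrite -/(rp _) -scalerBr -mulr_algl; apply: idealMr.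
by apply/qpiP; rewrite rpK.
Qed.

Fact quotient_scaleA c d x :
  quotient_scale c (quotient_scale d x) = quotient_scale (c * d) x.
Proof. by rewrite -(rpK x) !qpiZ scalerA. Qed.
Fact quotient_scale1 : left_id 1 quotient_scale.
Proof. by move=> x; rewrite -(rpK x) qpiZ scale1r. Qed.
Fact quotient_scaleDr : right_distributive quotient_scale +%R.
Proof.
by move=> c x y; rewrite -(rpK x) -(rpK y) -qpiD !qpiZ scalerDr qpiD.
Qed.
Fact quotient_scaleDl x : {morph quotient_scale^~ x : c d / c + d}.
Proof. by move=> c d; rewrite -(rpK x) !qpiZ scalerDl qpiD. Qed.
HB.instance Definition _ :=
  GRing.Zmodule_isLmodule.Build R[i] quotient quotient_scaleA quotient_scale1
    quotient_scaleDr quotient_scaleDl.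

Definition quotient_norm (x : quotient) : R[i] :=
  (inf [set rnorm a | a in [set a : A | qpi a = x]])%:C.

Let qn (x : quotient) : R := inf [set rnorm a | a in [set a : A | qpi a = x]].

Let qn_has_inf x : has_inf [set rnorm a | a in [set a : A | qpi a = x]].
Proof.
split; first by exists (rnorm (rp x)), (rp x) => //; exact: rpK.
by exists 0 => _ [a _ <-]; exact: rnorm_ge0.
Qed.

Let qn_le a : qn (qpi a) <= rnorm a.
Proof. by apply: ge_inf; [exact: (qn_has_inf _).2 | exists a]. Qed.

Let qn_adh x e : 0 < e -> exists a, qpi a = x /\ rnorm a < qn x + e.
Proof.
by move=> e0; have [_ [a ax <-] lt] := inf_adherent e0 (qn_has_inf x); exists a.
Qed.

Let qn_ge0 x : 0 <= qn x.
Proof.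
apply: lb_le_inf; first by have [] := qn_has_inf x.
by move=> _ [a _ <-]; exact: rnorm_ge0.
Qed.

Fact quotient_normD x y :
  quotient_norm (x + y) <= quotient_norm x + quotient_norm y.
Proof.
rewrite /quotient_norm -rmorphD lecR.
change (qn (x + y) <= qn x + qn y).
apply/ler_addgt0Pr => e e0; have e2 : 0 < e / 2 by rewrite divr_gt0.
have [a [<- ax]] := qn_adh x e2; have [b [<- bx]] := qn_adh y e2.
rewrite -qpiD; apply: le_trans (qn_le _) _; apply: le_trans (rnormD _ _) _.
by move: ax bx; rewrite ?rpK; lra.
Qed.

Fact quotient_normZ c x : quotient_norm (c *: x) = `|c| * quotient_norm x.
Proof.
rewrite /quotient_norm rnormE -rmorphM; congr _%:C; apply/eqP.
change (qn (c *: x) == rnorm c * qn x).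
have le d y : qn (d *: y) <= rnorm d * qn y.
  apply/ler_addgt0Pr => e e0.
  have e2 : 0 < e / (1 + rnorm d) by rewrite divr_gt0// ltr_pwDl// rnorm_ge0.
  have [b [by_ bn]] := qn_adh y e2.
  have -> : d *: y = qpi (d *: b) by rewrite -by_; exact: qpiZ.
  apply: le_trans (qn_le _) _; rewrite rnormZ.
  apply: le_trans (ler_wpM2l (rnorm_ge0 d) (ltW bn)) _.
  rewrite mulrDr lerD2l mulrCA ger_pMr// ler_pdivrMr ?mul1r ?lerDr//.
  by rewrite ltr_pwDl// rnorm_ge0.
rewrite eq_le; apply/andP; split; first exact: le.
have [->|c0] := eqVneq c 0; first by rewrite rnorm0 mul0r.
have cp : 0 < rnorm c.
  by rewrite lt_def rnorm_ge0 andbT; apply: contra_neq c0 => /rnorm_eq0.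
rewrite -(ler_pM2l (x := rnorm c^-1)); last first.
  by rewrite -(pmulr_rgt0 _ cp) -rnormM divff// rnorm1.
rewrite mulrA -rnormM mulVf// rnorm1 mul1r.
by rewrite -[X in qn X](scalerK c0) le.
Qed.

Fact quotient_norm0 x : quotient_norm x = 0 -> x = 0.
Proof.
move=> /(congr1 (@complex.Re _)) x0; have {}x0 : qn x = 0 by [].
rewrite -(rpK x) -qpi0; apply/qpiP; rewrite subr0.
apply: (ideal_closed (c := I)) => B /nbhs_ballP[_ /= /posC_real[e e0 ->]] Be.
have [a [ax an]] := qn_adh x e0.
exists (rp x - a); split; first by apply/qpiP; rewrite rpK.
by apply: Be; rewrite ball_rnormE opprB addrC subrK; rewrite x0 add0r in an.
Qed.
HB.instance Definition _ :=
  Lmodule_isNormed.Build R[i] quotient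
    quotient_normD quotient_normZ quotient_norm0.

Lemma rnorm_quotient (x : quotient) :
  rnorm x = inf [set rnorm a | a in [set a : A | qpi a = x]].
Proof. by []. Qed.

Lemma rnorm_qpi a : rnorm (qpi a) <= rnorm a.
Proof. exact: qn_le. Qed.

Lemma rnorm_lift (x : quotient) e : 0 < e ->
  exists a, qpi a = x /\ rnorm a < rnorm x + e.
Proof. exact: qn_adh. Qed.

Lemma quotient_fast (u : nat -> quotient) : fast u -> exists l, fast_limit u l.
Proof.
move=> fu.
have /choice[w wP] n : exists a, qpi a = u n.+2 - u n.+1 /\ rnorm a <= rate n.
  have [a [ax an]] := rnorm_lift (u n.+2 - u n.+1) (rate_gt0 R n.+1).
  exists a; split=> //; apply: le_trans (ltW an) _.
  by rewrite (rateS R n) mulr_natl mulr2n lerD2r; exact: fu.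
pose v n := rp (u 1%N) + \sum_(k < n) w k.
have vE n : qpi (v n) = u n.+1.
  elim: n => [|n IH]; first by rewrite /v big_ord0 addr0 rpK.
  by rewrite /v big_ord_recr /= addrA qpiD -/(v n) IH (wP n).1 addrC subrK.
have fv : fast v.
  move=> n; rewrite /v big_ord_recr /= addrA [X in rnorm X]addrC addKr.
  exact: (wP n).2.
have [l lP] := fast_cvg fv.
exists (qpi l); apply: fast_limitI => // e e0.
have [N Ne] := rate_small e0; exists N.+1 => -[//|n] nN.
rewrite -vE -qpiB; apply: le_trans (rnorm_qpi _) _.
apply: le_trans (lP n) _; apply: le_trans (ltW Ne).
rewrite ler_pM2l// -(subnKC (_ : N <= n)%N)//.
elim: (n - N)%N => [|m IH]; first by rewrite addn0.
apply: le_trans IH; rewrite addnS (rateS R (N + m)).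
by have := rate_gt0 R (N + m).+1; lra.
Qed.

HB.instance Definition _ :=
  Uniform_isComplete.Build quotient (cauchy_fast quotient_fast).

Fact quotient_mulA : associative quotient_mul.
Proof.
by move=> x y z; rewrite -(rpK x) -(rpK y) -(rpK z) !qpiM mulrA.
Qed.
Fact quotient_mul1 : left_id (qpi 1) quotient_mul.
Proof. by move=> x; rewrite -(rpK x) qpiM mul1r. Qed.
Fact quotient_mulr1 : right_id (qpi 1) quotient_mul.
Proof. by move=> x; rewrite -(rpK x) qpiM mulr1. Qed.
Fact quotient_mulDl : left_distributive quotient_mul +%R.
Proof.
by move=> x y z; rewrite -(rpK x) -(rpK y) -(rpK z) -qpiD !qpiM mulrDl qpiD.
Qed.
Fact quotient_mulDr : right_distributive quotient_mul +%R.
Proof.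
by move=> x y z; rewrite -(rpK x) -(rpK y) -(rpK z) -qpiD !qpiM mulrDr qpiD.
Qed.
Fact quotient_one_neq0 : qpi 1 != 0.
Proof.
by apply/eqP; rewrite -qpi0 => /qpiP; rewrite subr0 idealr1.
Qed.
Fact quotient_scaleAl c x y : c *: quotient_mul x y = quotient_mul (c *: x) y.
Proof.
rewrite -(rpK x) -(rpK y) qpiM -![_ *: qpi _]/(quotient_scale _ _).
by rewrite !qpiZ qpiM scalerAl.
Qed.
Fact quotient_scaleAr c x y : c *: quotient_mul x y = quotient_mul x (c *: y).
Proof.
rewrite -(rpK x) -(rpK y) qpiM -![_ *: qpi _]/(quotient_scale _ _).
by rewrite !qpiZ qpiM scalerAr.
Qed.
Fact quotient_normM (x y : quotient) : `|quotient_mul x y| <= `|x| * `|y|.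
Proof.
rewrite !rnormE -rmorphM lecR.
have bound e : 0 < e -> rnorm (quotient_mul x y) <= (rnorm x + e) * (rnorm y + e).
  move=> e0; have [a [ax an]] := rnorm_lift x e0.
  have [b [bx bn]] := rnorm_lift y e0.
  rewrite -{1}ax -{1}bx qpiM; apply: le_trans (rnorm_qpi _) _.
  apply: le_trans (ban_rnormM _ _) _.
  by rewrite ler_pM ?rnorm_ge0// ltW.
apply/ler_addgt0Pr => e e0.
have x0 := rnorm_ge0 x; have y0 := rnorm_ge0 y.
set p := rnorm x in bound x0 *; set q := rnorm y in bound y0 *.
pose d := Num.min 1 (e / (p + q + 1)).
have s0 : 0 < p + q + 1 by lra.
have d0 : 0 < d by rewrite lt_min ltr01 divr_gt0.
have d1 : d <= 1 by rewrite ge_min lexx.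
have de : d * (p + q + 1) <= e by rewrite -ler_pdivlMr// ge_min lexx orbT.
apply: le_trans (bound _ d0) _.
have dd : d * d <= d by rewrite ger_pMr.
by rewrite mulrDl !mulrDr; move: de; rewrite !mulrDr (mulrC p d); lra.
Qed.

Definition quotient_algebra : banachAlgebra R[i] :=
  BanachAlgebra quotient_mulA quotient_mul1 quotient_mulr1 quotient_mulDl
    quotient_mulDr quotient_one_neq0 quotient_scaleAl quotient_scaleAr
    quotient_normM.

End QuotientAlgebra.

Section ReducedPowers.
Variables (R : realType) (A : banachAlgebra R[i]).

(* c_0(A) is the case [F = \oo], and c_U(A) the case of an ultrafilter [F = U]. *)
Definition null_sequence (F : set_system nat) : pred (linfty_algebra A) :=
  fun a => `[< rnorm ((a : linfty A) n) @[n --> F] --> (0 : R) >].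

Section Filter.
Variables (F : set_system nat) (FF : ProperFilter F).

Lemma null_sequenceP (a : linfty_algebra A) :
  a \in null_sequence F <->
  forall e : R, 0 < e -> F [set n | rnorm ((a : linfty A) n) < e].
Proof.
rewrite unfold_in; split.
  move=> /asboolP/cvgr0Pnorm_lt aF e /aF; apply: filterS => n /=.
  by rewrite ger0_norm ?rnorm_ge0.
move=> aF; apply/asboolP/cvgr0Pnorm_lt => e /aF; apply: filterS => n /=.
by rewrite ger0_norm ?rnorm_ge0.
Qed.

Fact null_ideal : idealr_closed (null_sequence F).
Proof.
split.
- apply/null_sequenceP => e e0; apply: filterS filterT => n _ /=.
  by rewrite rnorm0.
- apply/negP => /null_sequenceP/(_ _ (rnorm_ban1_gt0 A))/filter_ex[n] /=.
  by rewrite ltxx.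
- move=> a u v /null_sequenceP uF /null_sequenceP vF; apply/null_sequenceP.
  move=> e e0; have e2 : 0 < e / 2 by rewrite divr_gt0.
  have p0 : 0 < 1 + rnorm (a : linfty A) by rewrite ltr_pwDl// rnorm_ge0.
  apply: filterS (filterI (uF _ (divr_gt0 e2 p0)) (vF _ e2)) => n [/= un vn].
  apply: le_lt_trans (rnormD _ _) _; rewrite [ltRHS](splitr e) ltrD//.
  apply: le_lt_trans (ban_rnormM _ _) _.
  rewrite ltr_pdivlMr// mulrC in un; apply: le_lt_trans un.
  rewrite ler_wpM2r ?rnorm_ge0//; apply: le_trans (ler_rnorm_linfty _ _) _.
  by rewrite lerDr.
Qed.

(* The phantom argument lets HB find the properness of the ideal. *)
Definition null_idealr (_ : ProperFilter F) := null_sequence F.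
HB.instance Definition _ :=
  isIdealr.Build (linfty_algebra A) (null_idealr FF) null_ideal.

Fact null_mulr a : {in null_idealr FF, forall u, u * a \in null_idealr FF}.
Proof.
move=> u /null_sequenceP uF; apply/null_sequenceP => e e0.
have p0 : 0 < 1 + rnorm (a : linfty A) by rewrite ltr_pwDl// rnorm_ge0.
apply: filterS (uF _ (divr_gt0 e0 p0)) => n /= un.
apply: le_lt_trans (ban_rnormM _ _) _.
rewrite ltr_pdivlMr// in un; apply: le_lt_trans un.
rewrite ler_wpM2l ?rnorm_ge0//; apply: le_trans (ler_rnorm_linfty _ _) _.
by rewrite lerDr.
Qed.

Fact null_closed : closed [set a : linfty_algebra A | a \in null_idealr FF].
Proof.
move=> a /= acl; apply/null_sequenceP => e e0.
have e2 : 0 < e / 2 by rewrite divr_gt0.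
have e2' : 0 < (e / 2)%:C by rewrite (ltcR 0).
have [b [/= /null_sequenceP/(_ _ e2) bF]] := acl _ (nbhsx_ballx a _ e2').
rewrite ball_rnormE => ab; apply: filterS bF => n /= bn.
rewrite -(subrK ((b : linfty A) n) ((a : linfty A) n)).
apply: le_lt_trans (rnormD _ _) _; rewrite [ltRHS](splitr e) ltrD//.
exact: le_lt_trans (ler_rnorm_linfty (a - b) n) ab.
Qed.

Definition null_closedIdeal : closedIdeal (linfty_algebra A) :=
  @ClosedIdeal _ (linfty_algebra A) (null_idealr FF) null_mulr null_closed.

Definition reduced_power : banachAlgebra R[i] := quotient_algebra null_closedIdeal.

End Filter.

Definition Asy : banachAlgebra R[i] := reduced_power eventually_filter.

Definition ultrapower (U : set_system nat) (UU : UltraFilter U) :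
  banachAlgebra R[i] := reduced_power ultra_proper.

End ReducedPowers.

Definition nonprincipal (T : Type) (U : set_system T) : Prop :=
  forall x, U <> principal_filter x.

(* Main.v *)
Require Import Defs.
From HB Require Import structures.
From mathcomp Require Import all_boot all_order all_algebra.
From mathcomp Require Import generic_quotient ring_quotient finmap.
From mathcomp Require Import all_classical all_reals all_analysis.
From mathcomp Require Import complex ring lra zify.
Set Implicit Arguments.
Unset Strict Implicit.
Unset Printing Implicit Defensive.
Import Order.TTheory GRing.Theory Num.Theory numFieldNormedType.Exports.
Local Open Scope classical_set_scope.
Local Open Scope ring_scope.
Local Open Scope complex_scope.

(* Stable rank one of l^1(Z): the closure of the invertible elements is stable
   under products, contains z - lambda for every scalar lambda (which is
   invertible when |lambda| <> 1), hence, since polynomials split, all Laurent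
   polynomials, and these are dense.

   For the reduced powers, let U be an ultrafilter containing the cofinite sets
   and G = Z^N / U. The map sending a bounded sequence (b_n) in l^1(Z) to its
   coefficients lim_U b_n(g_n), g in G, is a contractive unital homomorphism
   into l^1(G), because the sequences without atoms form an ideal. The group G
   is torsion-free and the classes of (1) and (n) are independent in it, so
   there are additive f1, f2 : G -> R with (f1, f2) equal to (1, 0) and (0, 1)
   at these classes, and characters e^{i(s f1 + t f2)} of l^1(G) for all real
   s, t. They turn an invertible b into a uniformly continuous nonvanishing
   function F(s, t), bounded away from 0. If b is close to
   -i (z - z^-1) + (z^n - z^-n), then F(s, t) is close to 2 sin s + 2 i sin t,
   which has winding number 1 along the boundary of [-pi/2, pi/2]^2: a
   contradiction. *)

(** * The closure of the group of invertible elements *)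

Section Invertible.
Variables (R : realType) (A : banachAlgebra R[i]).
Implicit Types (a b x y : A).

Lemma invertibleM a b : invertible a -> invertible b -> invertible (a * b).
Proof.
move=> [a' [aa' a'a]] [b' [bb' b'b]]; exists (b' * a').
by rewrite mulrA -(mulrA a) bb' mulr1 aa' mulrA -(mulrA b') a'a mulr1 b'b.
Qed.

Lemma invertible_scale (c : R[i]) a : c != 0 -> invertible a -> invertible (c *: a).
Proof.
move=> c0 [b [ab ba]]; exists (c^-1 *: b).
by rewrite -!scalerAl -!scalerAr !scalerA ab ba divff// mulVf// !scale1r.
Qed.

(** Only positive exponents: [rnorm 1] may exceed 1. *)
Lemma rnormX_le x n : rnorm (x ^+ n.+1) <= rnorm x ^+ n.+1.
Proof.
elim: n => [|n IH]; first by rewrite !expr1.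
rewrite !(exprS _ n.+1); apply: le_trans (ban_rnormM _ _) _.
by rewrite ler_wpM2l ?rnorm_ge0.
Qed.

(** At norm at most 1/2 the powers of [x] are dominated by [rate], so the Neumann series is [fast]
    and [fast_cvg] provides its sum. *)
Lemma neumann_half x : rnorm x <= 2^-1 -> invertible (1 - x).
Proof.
(* The series starts at [x], so that its increments are positive powers, bounded by [rate n]
   whatever the norm of [1]; the inverse is then [1 + l]. *)
move=> x2; pose u n := \sum_(k < n) x ^+ k.+1.
have rateE n : rate n = 2^-1 ^+ n.+1 :> R by rewrite /rate natrX div1r exprVn.
have pow n : rnorm (x ^+ n.+1) <= rate n.
  by rewrite rateE (le_trans (rnormX_le _ _))// lerXn2r ?nnegrE ?rnorm_ge0// invr_ge0.
have /fast_cvg[l lP] : fast u.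
  by move=> n; rewrite /u big_ord_recr /= [X in rnorm X]addrC addKr.
have uE n : u n = \sum_(k < n.+1) x ^+ k - 1.
  by rewrite big_ord_recl expr0 addrC addKr.
have comm n : u n * x = x * u n.
  rewrite /u mulr_suml mulr_sumr; apply: eq_bigr => i _.
  by rewrite -exprSr -exprS.
have uR n : (1 - x) * (1 + u n) = 1 - x ^+ n.+1.
  by rewrite uE (addrC 1 (_ - 1)) subrK -opprB mulNr -subrX1 opprB.
have uL n : (1 + u n) * (1 - x) = 1 - x ^+ n.+1.
  rewrite -uR; apply: commrB; first exact: commr1.
  by apply/commr_sym/commrD; [exact: commr1 | exact/esym/comm].
have x2' : rnorm (1 - x) <= rnorm (1 : A) + 2^-1.
  by apply: le_trans (rnormB _ _) _; rewrite lerD2l.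
set M := rnorm (1 : A) + 2^-1 in x2'.
have M0 : 0 <= M by apply: le_trans x2'; exact: rnorm_ge0.
(* [M * (2 * rate n)] bounds the product of [1 - x] with the tail [l - u n], and [rate n] bounds the
   remainder [x ^+ n.+1]. *)
have small (z : A) : (forall n, rnorm z <= M * (2 * rate n) + rate n) -> z = 0.
  move=> zs; apply/rnorm_eq0/eqP; rewrite eq_le rnorm_ge0 andbT.
  apply/ler_addgt0Pr => e e0; rewrite add0r.
  have M1 : 0 < M + 1 by lra.
  have [n ne] := rate_small (divr_gt0 e0 M1).
  apply: le_trans (zs n) _; rewrite ltr_pdivlMr// in ne.
  rewrite mulrDr mulr1 [_ * M]mulrC in ne.
  by have := rate_gt0 R n; lra.
exists (1 + l); split; apply/eqP; rewrite -subr_eq0; apply/eqP/small => n.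
- have -> : (1 - x) * (1 + l) - 1 = (1 - x) * (l - u n) - x ^+ n.+1.
    rewrite -[in LHS](subrK (u n) l) addrCA mulrDr uR.
    by rewrite -addrA; congr (_ + _); rewrite addrAC subrr sub0r.
  apply: le_trans (rnormB _ _) _; apply: lerD => //.
  apply: le_trans (ban_rnormM _ _) _; apply: ler_pM; rewrite ?rnorm_ge0//.
- have -> : (1 + l) * (1 - x) - 1 = (l - u n) * (1 - x) - x ^+ n.+1.
    rewrite -[in LHS](subrK (u n) l) addrCA mulrDl uL.
    by rewrite -addrA; congr (_ + _); rewrite addrAC subrr sub0r.
  apply: le_trans (rnormB _ _) _; apply: lerD => //.
  apply: le_trans (ban_rnormM _ _) _; rewrite mulrC; apply: ler_pM; rewrite ?rnorm_ge0//.
Qed.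

(** Some power of [x] has norm at most 1/2, and [1 - x] divides [1 - x ^+ m.+1] with cofactor the
    geometric sum [s]. Since [s] commutes with [1 - x ^+ m.+1], it commutes with the inverse [b],
    and [s * b] is a two-sided inverse. *)
Lemma neumann x : rnorm x < 1 -> invertible (1 - x).
Proof.
move=> x1; have [m mP] : exists m, rnorm (x ^+ m.+1) <= 2^-1.
  have h : (fun n => rnorm x ^+ n) @ \oo --> (0 : R).
    by apply: cvg_expr; rewrite ger0_norm ?rnorm_ge0.
  have i2 : 0 < (2^-1 : R) by rewrite invr_gt0.
  move/cvgr0Pnorm_le : h => /(_ _ i2)[N _ NP].
  exists N; apply: le_trans (rnormX_le _ _) _.
  have := NP N.+1 (leqnSn N) => /=; exact/le_trans/ler_norm.
have [b [bR bL]] := neumann_half mP.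
pose s := \sum_(k < m.+1) x ^+ k.
have sR : (1 - x) * s = 1 - x ^+ m.+1 by rewrite -opprB mulNr -subrX1 opprB.
have sL : s * (1 - x) = 1 - x ^+ m.+1.
  rewrite -sR mulrBl mulrBr mul1r mulr1; congr (_ - _).
  rewrite mulr_suml mulr_sumr; apply: eq_bigr => i _.
  by rewrite -exprSr -exprS.
have e : b * s = s * b.
  have c : s * (1 - x ^+ m.+1) = (1 - x ^+ m.+1) * s.
    by rewrite -{1}sR -sL mulrA.
  by rewrite -[s in LHS]mulr1 -bR [s * _]mulrA c !mulrA bL mul1r.
exists (s * b); split; first by rewrite mulrA sR.
by rewrite -e -mulrA sL.
Qed.

Definition inv_closure a : Prop :=
  forall e : R, 0 < e -> exists2 b, invertible b & rnorm (a - b) < e.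

Lemma stable_rank_oneP : stable_rank_one A <-> forall a, inv_closure a.
Proof.
split=> [sr a e e0|h].
  have [||b [/= ab ib]] := sr (ball a e%:C).
  - by exists a; apply: ballxx; rewrite (ltcR 0).
  - by apply: ball_open; rewrite (ltcR 0).
  - by exists b => //; rewrite -ball_rnormE.
move=> O [a Oa] oO.
have [_ /= /posC_real[e e0 ->] eO] :=
  (@nbhs_ballP _ A a O).1 (open_nbhs_nbhs (conj oO Oa)).
have [b ib ab] := h a e e0; exists b; split => //=.
by apply: eO; rewrite ball_rnormE.
Qed.

Lemma inv_closure_inv a : invertible a -> inv_closure a.
Proof. by move=> ia e e0; exists a => //; rewrite subrr rnorm0. Qed.

Lemma inv_closure_closed a :
  (forall e : R, 0 < e -> exists2 b, inv_closure b & rnorm (a - b) < e) -> inv_closure a.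
Proof.
move=> h e e0; have e2 : 0 < e / 2 by rewrite divr_gt0.
have [b /(_ _ e2)[c ic bc] ab] := h _ e2; exists c => //.
rewrite -(subrK b a) -addrA (le_lt_trans (rnormD _ _))//.
by rewrite [ltRHS]splitr ltrD.
Qed.

(** The factors are approximated one after the other: [a] by an invertible [c] at a precision set by
    [b], then [b] at a precision set by [c]. *)
Lemma inv_closureM a b : inv_closure a -> inv_closure b -> inv_closure (a * b).
Proof.
move=> ha hb.
have left c : invertible c -> inv_closure (c * b).
  move=> ic e e0; have c0 : 0 < 1 + rnorm c by rewrite ltr_pwDl// rnorm_ge0.
  have [d id bd] := hb _ (divr_gt0 e0 c0).
  exists (c * d); first exact: invertibleM.
  rewrite -mulrBr; apply: le_lt_trans (ban_rnormM _ _) _.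
  rewrite ltr_pdivlMr// in bd; apply: le_lt_trans bd.
  by rewrite mulrC ler_wpM2l ?rnorm_ge0// lerDr.
apply: inv_closure_closed => e e0.
have b0 : 0 < 1 + rnorm b by rewrite ltr_pwDl// rnorm_ge0.
have [c ic ac] := ha _ (divr_gt0 e0 b0).
exists (c * b); first exact: left.
rewrite -mulrBl; apply: le_lt_trans (ban_rnormM _ _) _.
rewrite ltr_pdivlMr// in ac; apply: le_lt_trans ac.
by rewrite ler_wpM2l ?rnorm_ge0// lerDr.
Qed.

Lemma invertible1 : invertible (1 : A).
Proof. by exists 1; rewrite mulr1. Qed.

Lemma inv_closure_scalar (c : R[i]) : inv_closure (c *: 1).
Proof.
have [->|c0] := eqVneq c 0; last exact/inv_closure_inv/invertible_scale/invertible1.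
(* Zero is approached by small nonzero multiples of [1]. *)
move=> e e0; have p : 0 < 1 + rnorm (1 : A) by rewrite ltr_pwDl// rnorm_ge0.
have q : 0 < e / (1 + rnorm (1 : A)) by rewrite divr_gt0.
exists ((e / (1 + rnorm (1 : A)))%:C *: 1).
  by apply: invertible_scale invertible1; apply/eqP => /complexI /eqP; rewrite gt_eqF.
rewrite scale0r sub0r rnormN rnormZ rnorm_real ?ltW//.
by rewrite -mulrA gtr_pMr// ltr_pdivrMl// mulr1 ltrDr.
Qed.

End Invertible.

(** * Stable rank one of l^1(Z) *)

Section FiniteSums.
Variable R : realType.
Local Notation summ g := (summable setT (fun i => (g i)%:E)).

Section Complex.
Variables (T : choiceType) (f : T -> R[i]).
Hypothesis sf : csummable f.

Lemma csummable_mask (p : pred T) : csummable (fun i => if p i then f i else 0).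
Proof. by apply: csummable_le sf => i; case: ifP; rewrite ?rnorm0 ?rnorm_ge0. Qed.

Lemma csummable_rest (s : seq T) : csummable (fun i => if i \in s then 0 else f i).
Proof.
by have := csummable_mask (fun i => i \notin s); under eq_fun do rewrite if_neg.
Qed.

Lemma csum_split (s : seq T) : uniq s ->
  csum f = \sum_(i <- s) f i + csum (fun i => if i \in s then 0 else f i).
Proof.
elim: s => [_|x s IH /= /andP[xs us]].
  by rewrite big_nil add0r; apply: eq_csum.
rewrite big_cons IH// [f x + _]addrC -addrA; congr (_ + _).
have s1 := csummable_rest (x :: s).
have s2 := csummable_mask (fun i => i == x).
have <- : csum (fun i => if i == x then f i else 0) = f x.
  by rewrite (csum_single (a := x)) ?eqxx// => i /negPf ->.
rewrite -csumD//; apply: eq_csum => i; rewrite inE.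
by have [->|] := eqVneq i x; rewrite ?(negPf xs) ?addr0 ?add0r.
Qed.

End Complex.

Lemma ssum_single (T : choiceType) (g : T -> R) a :
  (forall i, 0 <= g i) -> (forall i, i != a -> g i = 0) -> ssum g = g a.
Proof.
move=> g0 ga; rewrite /ssum (esumID [set a])//; last by move=> i _; rewrite lee_fin.
rewrite !setTI esum_set1 ?lee_fin// esum1 ?adde0//.
by move=> i /eqP/ga ->.
Qed.

Section Nonneg.
Variables (T : choiceType) (g : T -> R).
Hypothesis g0 : forall i, 0 <= g i.
Hypothesis sg : summ g.

Lemma summ_rest (s : seq T) : summ (fun i => if i \in s then 0 else g i).
Proof. by apply: summ_le sg => i; case: ifP => _; rewrite ?normr0 ?ger0_norm. Qed.

Lemma ssum_split (s : seq T) : uniq s ->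
  ssum g = \sum_(i <- s) g i + ssum (fun i => if i \in s then 0 else g i).
Proof.
elim: s => [_|x s IH /= /andP[xs us]].
  by rewrite big_nil add0r.
rewrite big_cons IH// [g x + _]addrC -addrA; congr (_ + _).
have s1 := summ_rest (x :: s).
pose h i := if i == x then g i else 0.
have h0 i : 0 <= h i by rewrite /h; case: ifP.
have sh : summ h.
  by apply: summ_le sg => i; rewrite /h; case: ifP => _; rewrite ?normr0 ?ger0_norm.
have <- : h x = g x by rewrite /h eqxx.
rewrite -(ssum_single h0); last by move=> i /negPf; rewrite /h => ->.
rewrite -ssumD//; last by move=> i; case: ifP.
congr ssum; apply/funext => i; rewrite /h inE.
by have [->|] := eqVneq i x; rewrite ?(negPf xs) ?addr0 ?add0r.
Qed.

Lemma ler_sum_ssum (s : seq T) : uniq s -> \sum_(i <- s) g i <= ssum g.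
Proof.
by move=> us; rewrite (ssum_split us) lerDl; apply: ssum_ge0 => i; case: ifP.
Qed.

(** The sum is the supremum of its finite partial sums; one of them within [e] of it leaves a
    remainder below [e]. *)
Lemma ssum_tail (e : R) : 0 < e ->
  exists2 s : seq T, uniq s & ssum (fun i => if i \in s then 0 else g i) < e.
Proof.
move=> e0; have gE := ssumE g0 sg.
have : (\esum_(i in setT) (g i)%:E)%E \is a fin_num by rewrite gE.
move=> /(ub_ereal_sup_adherent e0)[_ [X [Xfin _] <-]].
rewrite -[ereal_sup _]/(\esum_(i in setT) (g i)%:E)%E gE -EFinB.
rewrite fsbig_finite//= sumEFin lte_fin => lt_X.
have us := fset_uniq (fset_set X).
by exists (fset_set X) => //; move: (ssum_split us); lra.
Qed.

End Nonneg.

Lemma ssum_le_fin (T : choiceType) (g : T -> R) (M : R) :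
  (forall i, 0 <= g i) -> (forall s : seq T, uniq s -> \sum_(i <- s) g i <= M) ->
  summ g /\ ssum g <= M.
Proof.
move=> g0 gM; have EM : (\esum_(i in setT) (g i)%:E <= M%:E)%E.
  apply: ge_ereal_sup => _ [X [Xfin _] <-].
  rewrite fsbig_finite//= sumEFin lee_fin; exact/gM/fset_uniq.
have sg : summ g by apply/(summE g0); apply: le_lt_trans EM (ltry _).
by split=> //; rewrite -lee_fin -ssumE.
Qed.

End FiniteSums.

(** * Laurent polynomials in l^1(Z) *)

Section Delta.
Variable R : realType.
Local Notation A := (ell1Z_algebra R).

(** The Laurent monomial [z^m], built as a translate of the unit so that summability is
    inherited. *)
Definition delta (m : int) : A :=
  mk_ell1Z (reindex_csummable (sub_bij m) (ell1Z_one_subproof R)).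

Lemma deltaE m n : (delta m : ell1Z R) n = (n == m)%:R.
Proof. by rewrite /= subr_eq0. Qed.

Lemma delta0 : delta 0 = 1.
Proof. by apply: ell1Z_ext => n; rewrite deltaE. Qed.

Lemma delta_mulE m (b : A) n : (delta m * b : ell1Z R) n = (b : ell1Z R) (n - m).
Proof.
rewrite -[LHS]/(csum (fun k => (delta m : ell1Z R) k * (b : ell1Z R) (n - k))).
rewrite (csum_single (a := m)); first by rewrite deltaE eqxx mul1r.
by move=> i /negPf im; rewrite deltaE im mul0r.
Qed.

Lemma deltaD m n : delta (m + n) = delta m * delta n.
Proof.
by apply: ell1Z_ext => k; rewrite delta_mulE !deltaE addrC subr_eq.
Qed.

Lemma rnorm_delta m : rnorm (delta m) = 1.
Proof.
rewrite [LHS](@ssum_single _ _ _ m); first by rewrite deltaE eqxx rnorm1.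
- by move=> i; exact: rnorm_ge0.
- by move=> i /negPf im; rewrite deltaE im rnorm0.
Qed.

Lemma deltaX (n : nat) : delta n = delta 1 ^+ n.
Proof.
elim: n => [|n IH]; first by rewrite delta0.
by rewrite exprS -IH -deltaD.
Qed.

Lemma invertible_delta m : invertible (delta m).
Proof. by exists (delta (- m)); rewrite -!deltaD subrr addNr delta0. Qed.

(** For [|c| < 1] factor out [z], for [|c| > 1] factor out [-c]; what remains is a Neumann inverse.
    On the unit circle, [c] is a limit of points of the open disc. *)
Lemma inv_closure_linear (c : R[i]) : inv_closure (delta 1 - c *: 1).
Proof.
have inner (d : R[i]) : rnorm d < 1 -> invertible (delta 1 - d *: 1).
  move=> d1; have -> : delta 1 - d *: 1 = delta 1 * (1 - d *: delta (-1)).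
    by rewrite mulrBr mulr1 -scalerAr -deltaD subrr delta0.
  apply: invertibleM (invertible_delta _) (neumann _).
  by rewrite rnormZ rnorm_delta mulr1.
have [c1|c1|c1] := ltgtP (rnorm c) 1; first exact/inv_closure_inv/inner.
  apply: inv_closure_inv; have c0 : c != 0.
    by apply: contraTneq c1 => ->; rewrite rnorm0 ltr10.
  have -> : delta 1 - c *: 1 = (- c) *: (1 - c^-1 *: delta 1).
    by rewrite scalerBr !scaleNr opprK scalerA divff// scale1r addrC.
  apply: invertible_scale; first by rewrite oppr_eq0.
  apply: neumann; rewrite rnormZ rnorm_delta mulr1.
  have : rnorm c * rnorm c^-1 = 1 by rewrite -rnormM divff// rnorm1.
  move=> cc; rewrite -(ltr_pM2l (x := rnorm c)) ?cc ?mulr1//.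
  by apply: lt_trans c1.
(* Half the minimum gives [0 < r < 1] and [r < e]; replacing [c] by [(1 - r) c] moves it by [r] into
   the open unit disc. *)
move=> e e0; pose r := Num.min e 1 / 2.
have r0 : 0 < r by rewrite divr_gt0// lt_min e0 ltr01.
have r1 : r < 1 by rewrite /r ltr_pdivrMr// mul1r gt_min ltr1n orbT.
have re : r < e.
  by rewrite /r ltr_pdivrMr// gt_min; apply/orP; left; lra.
exists (delta 1 - ((1 - r)%:C * c) *: 1).
  by apply: inner; rewrite rnormM c1 mulr1 rnorm_real; lra.
rewrite opprB addrC addrA subrK -scalerBl.
have -> : (1 - r)%:C * c - c = - (r%:C * c).
  by rewrite rmorphB mulrBl mul1r addrAC subrr sub0r.
rewrite scaleNr rnormN rnormZ rnormM c1 mulr1 rnorm_real ?ltW//.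
by rewrite -delta0 rnorm_delta mulr1.
Qed.

Lemma inv_closure_poly (p : {poly R[i]}) : inv_closure (horner_alg (delta 1) p).
Proof.
have [r ->] := closed_field_poly_normal p.
rewrite -mul_polyC rmorphM /= horner_algC.
apply: inv_closureM; first exact: inv_closure_scalar.
rewrite rmorph_prod; elim/big_rec: _ => [|z x _ xD].
  exact/inv_closure_inv/invertible1.
apply: inv_closureM xD.
by rewrite rmorphB /= horner_algX horner_algC; exact: inv_closure_linear.
Qed.

Lemma ell1Z_trunc (a : A) (e : R) : 0 < e ->
  exists2 s : seq int, uniq s &
    rnorm (a - \sum_(k <- s) (a : ell1Z R) k *: delta k) < e.
Proof.
move=> e0; have [s us se] := ssum_tail (fun k => rnorm_ge0 ((a : ell1Z R) k)) (ell1ZP a) e0.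
exists s => //; apply: le_lt_trans se; rewrite [leLHS]rnorm_ell1Z.
rewrite le_eqVlt; apply/orP; left; apply/eqP; congr ssum; apply/funext => n.
have -> : (a - \sum_(k <- s) (a : ell1Z R) k *: delta k : ell1Z R) n =
   (a : ell1Z R) n - \sum_(k <- s) (a : ell1Z R) k * (n == k)%:R.
  rewrite -[LHS]/((a : ell1Z R) n - (\sum_(k <- s) (a : ell1Z R) k *: delta k : ell1Z R) n).
  congr (_ - _); elim: (s) => [|k t IH]; first by rewrite !big_nil.
  by rewrite !big_cons -IH -deltaE.
case: ifPn => ns.
  rewrite (bigD1_seq n)//= eqxx mulr1 big1_seq ?addr0 ?subrr ?rnorm0//.
  by move=> k /andP[/negPf nk _]; rewrite eq_sym nk mulr0.
rewrite big1_seq ?subr0// => k /andP[_ ks].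
by case: eqP => [nk|]; rewrite ?mulr0//; rewrite nk ks in ns.
Qed.

Lemma ell1Z_stable_rank_one : stable_rank_one A.
Proof.
apply/stable_rank_oneP => a; apply: inv_closure_closed => e e0.
have [s us se] := ell1Z_trunc a e0; exists (\sum_(k <- s) (a : ell1Z R) k *: delta k) => //.
(* Multiplication by [z^N] turns the truncation into a polynomial in [z], and [z^-N] is
   invertible. *)
have [N NP] : exists N : nat, forall k, k \in s -> 0 <= k + N%:Z.
  elim: (s) => [|k t [N NP]]; first by exists 0%N.
  exists (N + `|k|)%N => j; rewrite inE => /orP[/eqP ->|/NP jN].
    by rewrite PoszD; lia.
  by rewrite PoszD addrA addr_ge0.
have -> : \sum_(k <- s) (a : ell1Z R) k *: delta k = delta (- N%:Z) *
    horner_alg (delta 1) (\sum_(k <- s) (a : ell1Z R) k *: 'X^`|(k + N%:Z)%R|).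
  rewrite linear_sum mulr_sumr !big_seq; apply: eq_bigr => k ks.
  rewrite -mul_polyC rmorphM /= horner_algC rmorphXn /= horner_algX -deltaX.
  rewrite mulr_algl -scalerAr -deltaD.
  by rewrite gez0_abs ?NP// addrC addrK.
apply: inv_closureM (inv_closure_poly _); exact/inv_closure_inv/invertible_delta.
Qed.

End Delta.

(** * A winding number argument on a grid *)

Lemma rnorm_le_ReIm (R : realType) (z : R[i]) :
  rnorm z <= `|complex.Re z| + `|complex.Im z|.
Proof.
case: z => a b; rewrite -[a +i* b]/(Complex a b).
have -> : Complex a b = a%:C + 'i * b%:C.
  by apply/eqP; rewrite eq_complex /= !(mul0r, mul1r, mulr0, subr0, addr0, add0r) !eqxx.
apply: le_trans (rnormD _ _) _; rewrite rnormM.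
have rr (x : R) : rnorm x%:C = `|x|.
  by rewrite /rnorm normc_def /= expr0n /= addr0 sqrtr_sqr.
rewrite !rr /rnorm normc_def /= !(mul0r, mul1r, mulr0, subr0, addr0, add0r).
by rewrite expr0n /= add0r expr1n sqrtr1 mul1r.
Qed.

Section Grid.
Variables (R : realType) (N : nat) (F : nat -> nat -> R[i]) (d : R).
Hypothesis d0 : 0 < d.
Hypothesis F_ge : forall i j, (i <= N)%N -> (j <= N)%N -> d <= rnorm (F i j).
Hypothesis F_hor : forall i j, (i < N)%N -> (j <= N)%N ->
  rnorm (F i.+1 j - F i j) < d / 8.
Hypothesis F_ver : forall i j, (i <= N)%N -> (j < N)%N ->
  rnorm (F i j.+1 - F i j) < d / 8.
Hypothesis F_left : forall j, (j <= N)%N -> complex.Re (F 0%N j) < 0.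
Hypothesis F_right : forall j, (j <= N)%N -> 0 < complex.Re (F N j).
Hypothesis F_bot : forall i, (i <= N)%N -> complex.Im (F i 0%N) < 0.
Hypothesis F_top : forall i, (i <= N)%N -> 0 < complex.Im (F i N).

(* An edge is marked when [F] crosses the negative real half-axis along it. The
   number of marked edges is even around each cell, so it would be even around
   the whole grid, but the four boundary conditions make it odd. *)
Let Y i j : bool := complex.Re (F i j) < 0.
Let X i j : bool := 0 <= complex.Im (F i j).
Let h i j := Y i j && (X i j (+) X i.+1 j).
Let v i j := Y i j && (X i j (+) X i j.+1).

(** A sign change of [Im] between [p] and the nearby [q] forces [|Im p| <= d / 8], hence
    [|Re p| >= 7 d / 8], and a move by less than [d / 2] cannot change the sign of [Re]. *)
Let sign_change (p q r : R[i]) : d <= rnorm p ->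
  (0 <= complex.Im p) != (0 <= complex.Im q) ->
  rnorm (q - p) < d / 8 -> rnorm (r - p) < d / 2 ->
  (complex.Re p < 0) = (complex.Re r < 0).
Proof.
move=> dp pq qp rp.
have := ler_Im_rnorm (q - p); have := ler_Re_rnorm (r - p).
move: dp (rnorm_le_ReIm p) pq qp rp.
case: p => a b; case: q => a' b'; case: r => a'' b'' /=.
set nq := rnorm (_ - _); set nr := rnorm (_ - _); set np := rnorm _.
move=> h1 h2 pq qp rp; rewrite !ler_norml => /andP[r1 r2] /andP[q1 q2].
have [b1 b2] : b <= d / 8 /\ - (d / 8) <= b.
  by move: pq; case: (lerP 0 b) => hb; case: (lerP 0 b') => hb' // _; lra.
have nb : `|b| <= d / 8 by rewrite ler_norml b1 b2.
have [a0|a0] := ltrP a 0.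
  have na := ltr0_norm a0.
  have -> : a'' < 0 by lra.
  by [].
have na := ger0_norm a0.
have a''0 : 0 < a'' by lra.
by rewrite ltNge ltW.
Qed.

Let far (p q r : R[i]) : rnorm (q - p) < d / 8 -> rnorm (r - q) < d / 8 ->
  rnorm (r - p) < d / 2.
Proof.
move=> h1 h2; rewrite -(subrK q r) -addrA.
apply: le_lt_trans (rnormD _ _) _; apply: lt_le_trans (ltrD h2 h1) _.
by have := d0; lra.
Qed.

Let near (p q : R[i]) : rnorm (q - p) < d / 8 -> rnorm (q - p) < d / 2.
Proof. by move=> h1; apply: lt_le_trans h1 _; have := d0; lra. Qed.

(** If the sign of [Im] changes between the corner [(i, j)] and a neighbour, [Y] agrees at the three
    base points of the four edges, and a closed loop has an even number of sign changes. Otherwise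
    only the opposite corner can differ. *)
Let cell i j : (i < N)%N -> (j < N)%N ->
  h i j (+) h i j.+1 (+) v i j (+) v i.+1 j = false.
Proof.
move=> iN jN; have [iN' jN'] := (ltnW iN, ltnW jN).
have h0 := F_hor iN jN'; have h1 := F_hor iN jN.
have v0 := F_ver iN' jN; have v1 := F_ver iN jN.
have h0' := h0; rewrite rnorm_distC in h0'.
have v0' := v0; rewrite rnorm_distC in v0'.
have [xh|xh] := eqVneq (X i j) (X i.+1 j); last first.
  have e1 : Y i j = Y i.+1 j by exact: sign_change (F_ge iN' jN') xh h0 (near h0).
  have e2 : Y i j = Y i j.+1 by exact: sign_change (F_ge iN' jN') xh h0 (near v0).
  rewrite /h /v -e1 -e2.
  by case: (Y i j); case: (X i j); case: (X i.+1 j); case: (X i j.+1); case: (X i.+1 j.+1).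
have [xv|xv] := eqVneq (X i j) (X i j.+1); last first.
  have e1 : Y i j = Y i.+1 j by exact: sign_change (F_ge iN' jN') xv v0 (near h0).
  have e2 : Y i j = Y i j.+1 by exact: sign_change (F_ge iN' jN') xv v0 (near v0).
  rewrite /h /v -e1 -e2.
  by case: (Y i j); case: (X i j); case: (X i.+1 j); case: (X i j.+1); case: (X i.+1 j.+1).
have [xd|xd] := eqVneq (X i j.+1) (X i.+1 j.+1).
  by rewrite /h /v -xh -xv -xd -xv !addbb !andbF.
have xd' : X i.+1 j != X i.+1 j.+1 by rewrite -xh xv.
(* The two crossing edges meet at the opposite corner; their base points are two steps apart, whence
   the margin [d / 2] in [sign_change]. *)
have e1 : Y i j.+1 = Y i.+1 j.
  exact: (sign_change (F_ge iN' jN) xd h1 (far v0' h0)).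
by rewrite /h /v -e1 -xh -xv !addbb !andbF addbF addbb.
Qed.

Lemma grid_zero : False.
Proof.
(* The parity of the marked vertical edges on line [i] below height [k]. Adding up [cell] over a
   strip gives [step], a discrete Stokes formula. *)
pose V k i := \big[addb/false]_(j < k) v i j.
have step i k : (i < N)%N -> (k <= N)%N -> V k i (+) V k i.+1 = h i 0%N (+) h i k.
  move=> iN; elim: k => [|k IH] kN; first by rewrite /V !big_ord0 !addbb.
  have := cell iN kN; rewrite /V !big_ord_recr /=; have := IH (ltnW kN); rewrite /V.
  by do 2!case: (\big[_/_]_(_ < _) _); do 3!case: (h _ _); do 2!case: (v _ _).
(* [Im] keeps its sign along the bottom and along the top, so [V N] is the same on all vertical
   lines. It is even on the right, where [Re > 0]; on the left, where [Re < 0], it counts all sign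
   changes of [Im] from bottom to top, an odd number. *)
have hb i : (i < N)%N -> h i 0%N = false.
  move=> iN; rewrite /h /X !leNgt !F_bot ?(ltnW iN)//=.
  by rewrite andbF.
have ht i : (i < N)%N -> h i N = false.
  by move=> iN; rewrite /h /X !ltW ?F_top ?(ltnW iN)//= andbF.
have VE i : (i <= N)%N -> V N i = V N 0%N.
  elim: i => [_|i IH iN]; first by [].
  rewrite -(IH (ltnW iN)).
  have := step _ _ iN (leqnn N); rewrite hb// ht//.
  by case: (V N i); case: (V N i.+1).
have VN : V N N = false.
  rewrite /V big1// => j _; rewrite /v /Y ltNge ltW// F_right//.
  exact: ltnW (ltn_ord j).
have V0 k : (k <= N)%N -> V k 0%N = X 0%N 0%N (+) X 0%N k.
  elim: k => [|k IH] kN; first by rewrite /V big_ord0 addbb.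
  have -> : V k.+1 0%N = V k 0%N (+) v 0%N k by rewrite /V big_ord_recr.
  rewrite (IH (ltnW kN)) /v /Y (F_left (ltnW kN)) /=.
  by case: (X _ _); case: (X _ _); case: (X _ _).
have := VE N (leqnn N); rewrite VN V0// /X leNgt F_bot//=.
by rewrite ltW// F_top.
Qed.

End Grid.

(** * Linear functionals and the complex exponential *)

(* If [M] is maximal among the subspaces containing [W] but not [v], then
   [V] is the sum of [M] and the line spanned by [v]. *)
Lemma linear_functional (K : fieldType) (V : lmodType K) (W : set V) (v : V) :
  W 0 -> (forall c x y, W x -> W y -> W (c *: x + y)) -> ~ W v ->
  exists f : V -> K, [/\ forall c x y, f (c *: x + y) = c * f x + f y,
    f v = 1 & forall w, W w -> f w = 0].
Proof.
move=> W0 Wlin Wv.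
pose lin (M : set V) := forall c x y, M x -> M y -> M (c *: x + y).
(* The condition bears on the union of [X] with [W], so that it also holds for the empty set, the
   union of the empty chain. *)
pose P (X : set V) := lin (X `|` W) /\ ~ (X `|` W) v.
have [] := @Zorn_bigcup V P.
  move=> C CP Ctot; have inl x X : C X -> (X `|` W) x -> (\bigcup_(X in C) X `|` W) x.
    by move=> CX [Xx|]; [left; exists X|right].
  split; last by move=> [[X CX Xv]|//]; have [_] := CP _ CX; apply; left.
  move=> c x y [[X CX Xx]|Wx] [[X' CX' Xy]|Wy].
  - have [XX'|X'X] := Ctot _ _ CX CX'.
      by apply: (inl _ _ CX'); apply: (CP _ CX').1; left => //; exact: XX'.
    by apply: (inl _ _ CX); apply: (CP _ CX).1; left => //; exact: X'X.
  - by apply: (inl _ _ CX); apply: (CP _ CX).1; [left|right].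
  - by apply: (inl _ _ CX'); apply: (CP _ CX').1; [right|left].
  - by right; exact: Wlin.
move=> X0 [[Mlin Mv] Xmax]; set M := X0 `|` W in Mlin Mv.
have M0 : M 0 by right.
have MZ c x : M x -> M (c *: x) by move=> Mx; rewrite -[_ *: _]addr0; exact: Mlin.
have MN x : M x -> M (- x) by rewrite -scaleN1r; exact: MZ.
have MD x y : M x -> M y -> M (x + y) by rewrite -{2}[x]scale1r; exact: Mlin.
have MB x y : M x -> M y -> M (x - y) by move=> Mx /MN; exact: MD.
have /choice[f fP] x : exists k, M (x - k *: v).
  have [Mx|nMx] := pselect (M x); first by exists 0; rewrite scale0r subr0.
  (* [B] is the sum of [M] and the line spanned by [x]; by maximality it contains [v], and the
     relation can be solved for [x]. *)
  pose B := [set y | exists k, M (y - k *: x)].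
  have MB' y : M y -> B y by exists 0; rewrite scale0r subr0.
  have Bx : B x by exists 1; rewrite scale1r subrr.
  have BE : B `|` W = B by apply/setUidPl => y Wy; apply: MB'; right.
  have : X0 `<` B.
    split; first by move=> y Xy; apply: MB'; left.
    by move=> BX; apply: nMx; left; exact: BX.
  move=> /Xmax; rewrite /P BE => /not_andP[|].
    move=> nl; exfalso; apply: nl => c y z [k yk] [l zl]; exists (c * k + l).
    have -> : c *: y + z - (c * k + l) *: x = c *: (y - k *: x) + (z - l *: x).
      by rewrite scalerDl scalerBr scalerA opprD addrACA.
    exact: Mlin.
  move=> /contrapT[k vk]; have k0 : k != 0.
    by apply/eqP => k0; apply: Mv; rewrite k0 scale0r subr0 in vk.
  exists k^-1; have -> : x - k^-1 *: v = - k^-1 *: (v - k *: x).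
    by rewrite scalerBr scalerA mulNr mulVf// scaleN1r opprK scaleNr addrC.
  exact: MZ.
(* The coefficient along [v] is unique because [v] is not in [M]; linearity of [f] follows. *)
have funi x k : M (x - k *: v) -> f x = k.
  move=> Mk; apply/eqP; rewrite -subr_eq0; apply: contrapT => /negP fk0; apply: Mv.
  have := MB _ _ Mk (fP x); rewrite opprB addrC addrA subrK -scalerBl.
  by move=> /(MZ (f x - k)^-1); rewrite scalerA mulVf// scale1r.
exists f; split.
- move=> c x y; apply: funi.
  have -> : c *: x + y - (c * f x + f y) *: v = c *: (x - f x *: v) + (y - f y *: v).
    by rewrite scalerDl scalerBr scalerA opprD addrACA.
  exact: Mlin.
- by apply: funi; rewrite scale1r subrr.
- by move=> w Ww; apply: funi; rewrite scale0r subr0; right.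
Qed.

(** * The exponential map to the unit circle *)

Section Cis.
Variable R : realType.

Definition cis (x : R) : R[i] := cos x +i* sin x.

Lemma cisD x y : cis (x + y) = cis x * cis y.
Proof.
by rewrite /cis cosD sinD; apply/eqP; rewrite eq_complex /= eqxx addrC mulrC eqxx.
Qed.

Lemma rnorm_cis x : rnorm (cis x) = 1.
Proof. by rewrite /rnorm normc_def /= cos2Dsin2 sqrtr1. Qed.

Lemma cis_near0 (e : R) : 0 < e ->
  exists2 r : R, 0 < r & forall x, `|x| < r -> rnorm (cis x - 1) < e.
Proof.
move=> e0; have e2 : 0 < e / 2 by rewrite divr_gt0.
have /cvgrPdist_lt/(_ _ e2)/nbhs_ballP[r1 /= r10 h1] := @continuous_cos R 0.
have /cvgrPdist_lt/(_ _ e2)/nbhs_ballP[r2 /= r20 h2] := @continuous_sin R 0.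
exists (Num.min r1 r2); first by rewrite lt_min r10.
move=> x; rewrite lt_min => /andP[x1 x2].
have := h1 x; have := h2 x; rewrite /ball /= !sub0r !normrN cos0 sin0 sub0r normrN.
move=> /(_ x2) s /(_ x1) c; apply: le_lt_trans (rnorm_le_ReIm _) _ => /=.
by rewrite [ltRHS]splitr oppr0 addr0 ltrD// distrC.
Qed.

End Cis.

(** * Ultralimits and the group Z^N / U *)

Section UltraLimit.
Variables (R : realType) (U : set_system nat) (UU : UltraFilter U).
Implicit Types (u v : nat -> R[i]) (l k : R[i]).

Lemma ultra_or (A : set nat) : U A \/ U (~` A).
Proof. exact: in_ultra_setVsetC. Qed.

(** The limit is the supremum of the reals lying below [u n] for [U]-almost all [n]; the estimate
    from above uses that [U] contains each set or its complement. *)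
Lemma real_ultralimit (u : nat -> R) (M : R) : (forall n, `|u n| <= M) ->
  exists x : R, forall e : R, 0 < e -> U [set n | `|u n - x| < e].
Proof.
move=> uM; pose S := [set x | U [set n | x <= u n]].
have SM : has_sup S.
  split.
    exists (- M); apply: filterS filterT => n _ /=.
    by have := uM n; rewrite ler_norml => /andP[].
  exists M => x /filter_ex[n /= xu]; apply: le_trans xu _.
  exact: le_trans (ler_norm _) (uM n).
exists (sup S) => e e0.
have h1 : U [set n | sup S - e < u n].
  have [x Sx xe] := sup_adherent e0 SM.
  by apply: filterS Sx => n; exact: lt_le_trans.
have h2 : U [set n | u n < sup S + e].
  have [Se|] := ultra_or [set n | sup S + e <= u n].
    have := sup_upper_bound SM Se; by rewrite gerDl leNgt e0.
  by apply: filterS => n /=; rewrite ltNge => /negP.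
apply: filterS (filterI h1 h2) => n [/= a b].
by rewrite ltr_distl a b.
Qed.

Definition is_ulim u l := forall e : R, 0 < e -> U [set n | rnorm (u n - l) < e].

Lemma is_ulim_exists u (M : R) : (forall n, rnorm (u n) <= M) -> exists l, is_ulim u l.
Proof.
move=> uM.
have [|a aP] := @real_ultralimit (fun n => complex.Re (u n)) M.
  by move=> n; exact: le_trans (ler_Re_rnorm _) (uM n).
have [|b bP] := @real_ultralimit (fun n => complex.Im (u n)) M.
  by move=> n; exact: le_trans (ler_Im_rnorm _) (uM n).
exists (a +i* b) => e e0; have e2 : 0 < e / 2 by rewrite divr_gt0.
apply: filterS (filterI (aP _ e2) (bP _ e2)) => n [/= ha hb].
apply: le_lt_trans (rnorm_le_ReIm _) _; rewrite [ltRHS]splitr.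
by move: ha hb; case: (u n) => x y /= ha hb; rewrite ltrD.
Qed.

Lemma is_ulim_unique u l k : is_ulim u l -> is_ulim u k -> l = k.
Proof.
move=> ul uk; apply/eqP; rewrite -subr_eq0; apply/eqP/rnorm_eq0/eqP.
rewrite eq_le rnorm_ge0 andbT; apply/ler_addgt0Pr => e e0; rewrite add0r.
have e2 : 0 < e / 2 by rewrite divr_gt0.
have [n [/= h1 h2]] := filter_ex (filterI (ul _ e2) (uk _ e2)).
rewrite -(subrK (u n) l) -addrA; apply: le_trans (rnormD _ _) _.
by rewrite [leRHS]splitr lerD// ltW// rnorm_distC.
Qed.

Lemma is_ulim_ae u v l : U [set n | u n = v n] -> is_ulim u l -> is_ulim v l.
Proof.
move=> uv ul e e0; apply: filterS (filterI uv (ul _ e0)) => n [/= ->]//.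
Qed.

Lemma is_ulim_cst l : is_ulim (fun=> l) l.
Proof. by move=> e e0; apply: filterS filterT => n _ /=; rewrite subrr rnorm0. Qed.

Lemma is_ulimD u v l k : is_ulim u l -> is_ulim v k ->
  is_ulim (fun n => u n + v n) (l + k).
Proof.
move=> ul vk e e0; have e2 : 0 < e / 2 by rewrite divr_gt0.
apply: filterS (filterI (ul _ e2) (vk _ e2)) => n [/= h1 h2].
rewrite opprD addrACA; apply: le_lt_trans (rnormD _ _) _.
by rewrite [ltRHS]splitr ltrD.
Qed.

Lemma is_ulimZ c u l : is_ulim u l -> is_ulim (fun n => c * u n) (c * l).
Proof.
move=> ul e e0; have c0 : 0 < 1 + rnorm c by rewrite ltr_pwDl// rnorm_ge0.
apply: filterS (ul _ (divr_gt0 e0 c0)) => n /= h.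
rewrite -mulrBr rnormM; rewrite ltr_pdivlMr// in h; apply: le_lt_trans h.
by rewrite mulrC ler_wpM2l ?rnorm_ge0// lerDr.
Qed.

Lemma is_ulim_le u l (M : R) : is_ulim u l -> U [set n | rnorm (u n) <= M] -> rnorm l <= M.
Proof.
move=> ul uM; apply/ler_addgt0Pr => e e0.
have [n [/= h1 h2]] := filter_ex (filterI (ul _ e0) uM).
rewrite -(subrK (u n) l) addrC; apply: le_trans (rnormD _ _) _.
by rewrite lerD// ltW// rnorm_distC.
Qed.

End UltraLimit.

(** * Integer sequences modulo equality along the ultrafilter *)

Section Hyperintegers.
Variables (U : set_system nat) (UU : UltraFilter U).

(** The ultrafilter proof is an argument so that the subgroup structure, which depends on it, can be
    inferred from the predicate. *)
Definition ae_zero (_ : UltraFilter U) : {pred (nat -> int)} :=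
  fun g => `[< U [set n | g n = 0] >].

Fact ae_zero_zmod : zmod_closed (ae_zero UU).
Proof.
split; first by apply/asboolP; apply: filterS filterT => n _.
move=> g h /asboolP Ug /asboolP Uh; apply/asboolP.
apply: filterS (filterI Ug Uh) => n [/= gn hn].
exact: etrans (congr2 (fun a b : int => a - b) gn hn) (subrr 0).
Qed.
HB.instance Definition _ :=
  GRing.isZmodClosed.Build (nat -> int)%type (ae_zero UU) ae_zero_zmod.

Definition hyperint : zmodType := {ideal_quot (ae_zero UU)}.

Definition hcl (g : nat -> int) : hyperint := \pi_{ideal_quot (ae_zero UU)}%qT g.
Definition hrep (x : hyperint) : nat -> int := repr (x : {ideal_quot (ae_zero UU)}).

Lemma hrepK x : hcl (hrep x) = x. Proof. exact: reprK. Qed.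

Lemma hclP g h : hcl g = hcl h <-> U [set n | g n = h n].
Proof.
have -> : (hcl g = hcl h) <-> (g - h \in ae_zero UU).
  by rewrite /hcl (@Quotient.idealrBE _ (ae_zero UU)); split=> [->|/eqP].
split=> [/asboolP|gh].
  by apply: filterS => n /= /eqP; rewrite [X in X == _]/(g n - h n) subr_eq0 => /eqP.
apply/asboolP; apply: filterS gh => n /= gh.
exact: etrans (congr1 (fun a : int => a - h n) gh) (subrr _).
Qed.

Lemma hclD g h : hcl (g + h) = hcl g + hcl h.
Proof. exact: (pi_addr (s := {ideal_quot (ae_zero UU)})). Qed.
Lemma hclN g : hcl (- g) = - hcl g.
Proof. exact: (pi_oppr (s := {ideal_quot (ae_zero UU)})). Qed.
Lemma hcl0 : hcl 0 = 0.
Proof. exact: (pi_zeror (s := {ideal_quot (ae_zero UU)})). Qed.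
Lemma hclB g h : hcl (g - h) = hcl g - hcl h.
Proof. by rewrite hclD hclN. Qed.

End Hyperintegers.

Lemma subl_bijective (V : zmodType) (a : V) : bijective (fun x => a - x).
Proof. by exists (fun x => a - x) => x; rewrite subKr. Qed.

Lemma subr_bijective (V : zmodType) (a : V) : bijective (fun x => x - a).
Proof. by exists (fun x => x + a) => x; rewrite ?subrK ?addrK. Qed.

(** * The homomorphism to l^1(Z^N / U) *)

Section AtomicPart.
Variables (R : realType) (U : set_system nat) (UU : UltraFilter U).
Local Notation A := (ell1Z_algebra R).
Local Notation B := (linfty_algebra A).
Local Notation G := (hyperint UU).
Local Notation cl := (hcl UU).
Local Notation summ g := (summable setT (fun i => (g i)%:E)).
Implicit Types (b c : B) (x y : G).

Definition coef b (n : nat) (k : int) : R[i] := ((b : linfty A) n : ell1Z R) k.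

Lemma coef_le b n k : rnorm (coef b n k) <= rnorm ((b : linfty A) n).
Proof.
rewrite [leRHS]rnorm_ell1Z.
by apply: (ler_ssum (g := fun k => rnorm (coef b n k))) (ell1ZP _) => j; exact: rnorm_ge0.
Qed.

(** The default 0 of [xget] never occurs: the coefficients are bounded, so the ultralimit exists. *)
Definition atom b x : R[i] := xget 0 (is_ulim U (fun n => coef b n (hrep x n))).

(** The limit may be computed along any representative of the class, since two of them agree on a
    set of [U]. *)
Lemma atomP b (g : nat -> int) : is_ulim U (fun n => coef b n (g n)) (atom b (cl g)).
Proof.
have [|l lP] := @is_ulim_exists R U UU (fun n => coef b n (hrep (cl g) n)) (rnorm b).
  by move=> n; apply: le_trans (coef_le _ _ _) _; exact: ler_rnorm_linfty.
have : is_ulim U (fun n => coef b n (hrep (cl g) n)) (atom b (cl g)).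
  by rewrite /atom; case: xgetP => [y -> //|/(_ l)].
apply: is_ulim_ae; have /hclP : cl (hrep (cl g)) = cl g by rewrite hrepK.
by apply: filterS => n /= ->.
Qed.

Lemma atom_unique b (g : nat -> int) l :
  is_ulim U (fun n => coef b n (g n)) l -> atom b (cl g) = l.
Proof. exact/is_ulim_unique/atomP. Qed.

Lemma atomD b c x : atom (b + c) x = atom b x + atom c x.
Proof.
rewrite -(hrepK x); apply: atom_unique.
exact: is_ulimD (atomP b _) (atomP c _).
Qed.

Lemma atomZ (k : R[i]) b x : atom (k *: b) x = k * atom b x.
Proof. rewrite -(hrepK x); apply: atom_unique; exact: is_ulimZ (atomP b _). Qed.

Lemma atom0 x : atom 0 x = 0.
Proof. by rewrite -(scale0r (0 : B)) atomZ mul0r. Qed.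

Lemma atomN b x : atom (- b) x = - atom b x.
Proof. by rewrite -scaleN1r atomZ mulN1r. Qed.

Lemma atom_sum (I : Type) (s : seq I) (F : I -> B) x :
  atom (\sum_(i <- s) F i) x = \sum_(i <- s) atom (F i) x.
Proof.
elim: s => [|i s IH]; first by rewrite !big_nil atom0.
by rewrite !big_cons atomD IH.
Qed.

Lemma atom_ae b c :
  (forall e : R, 0 < e -> U [set n | rnorm ((b : linfty A) n - (c : linfty A) n) < e]) ->
  atom b =1 atom c.
Proof.
move=> bc x; rewrite -(hrepK x); apply/esym/atom_unique => e e0.
have e2 : 0 < e / 2 by rewrite divr_gt0.
apply: filterS (filterI (bc _ e2) (atomP b (hrep x) e2)) => n [/= h1 h2].
rewrite -(subrK (coef b n (hrep x n)) (coef c n _)) -addrA.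
apply: le_lt_trans (rnormD _ _) _; rewrite [ltRHS]splitr ltrD//.
rewrite rnorm_distC; apply: le_lt_trans h1.
exact: (coef_le (b - c) n (hrep x n)).
Qed.

(** Finitely many distinct classes are seen at distinct integers for almost all [n], so their atoms
    are limits of distinct coefficients of one element of l^1(Z). *)
Lemma ae_inj (s : seq G) : uniq s ->
  U [set n | {in s &, injective (fun x => hrep x n)}].
Proof.
elim: s => [_|x s IH /= /andP[xs us]]; first by apply: filterS filterT.
have Ux (t : seq G) : x \notin t -> U [set n | forall y, y \in t -> hrep x n <> hrep y n].
  elim: t => [_|y t IHt]; first by apply: filterS filterT.
  rewrite inE negb_or => /andP[xy xt].
  have [|h] := ultra_or UU [set n | hrep x n = hrep y n].
    by move/hclP; rewrite !hrepK => /eqP; rewrite (negPf xy).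
  apply: filterS (filterI h (IHt xt)) => n [/= h1 h2] z.
  by rewrite inE => /orP[/eqP -> //|]; exact: h2.
apply: filterS (filterI (Ux s xs) (IH us)) => n [/= h1 h2] y z.
rewrite !inE => /orP[/eqP->|ys] /orP[/eqP->|zs] // e.
- by case: (h1 z zs).
- by case: (h1 y ys).
- exact: h2.
Qed.

Lemma ae_all (s : seq G) (P : G -> nat -> Prop) :
  (forall x, U [set n | P x n]) -> U [set n | forall x, x \in s -> P x n].
Proof.
move=> UP; elim: s => [|x s IH]; first by apply: filterS filterT.
apply: filterS (filterI (UP x) IH) => n [/= h1 h2] y.
by rewrite inE => /orP[/eqP->|]//; exact: h2.
Qed.

Lemma sum_atom_le b (M : R) (s : seq G) : uniq s ->
  U [set n | rnorm ((b : linfty A) n) <= M] -> \sum_(x <- s) rnorm (atom b x) <= M.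
Proof.
move=> us bM; apply/ler_addgt0Pr => e e0.
have p0 : 0 < (size s).+1%:R :> R by rewrite ltr0n.
pose d := e / (size s).+1%:R.
have d0 : 0 < d by rewrite divr_gt0.
have lim x : U [set n | rnorm (coef b n (hrep x n) - atom b x) < d].
  by have := atomP b (hrep x) d0; rewrite hrepK.
(* A single [n] at which the norm bound holds, the representatives are distinct on [s], and every
   coefficient is within [d] of its atom. *)
have [n [[/= h1 h2] h3]] := filter_ex (filterI (filterI bM (ae_inj us))
  (@ae_all s (fun x n => rnorm (coef b n (hrep x n) - atom b x) < d) lim)).
apply: (@le_trans _ _ (\sum_(x <- s) (rnorm (coef b n (hrep x n)) + d))).
  rewrite !big_seq; apply: ler_sum => x xs.
  rewrite -(subrK (coef b n (hrep x n)) (atom b x)) addrC.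
  apply: le_trans (rnormD _ _) _; rewrite lerD2l ltW// rnorm_distC; exact: h3.
rewrite big_split /= lerD//.
  apply: le_trans h1; rewrite rnorm_ell1Z.
  rewrite -(big_map (fun x => hrep x n) xpredT (fun k => rnorm (coef b n k))).
  apply: ler_sum_ssum; first by move=> k; exact: rnorm_ge0.
    exact: ell1ZP.
  by rewrite map_inj_in_uniq.
rewrite big_const_seq count_predT iter_addr_0 -mulr_natr /d.
by rewrite -mulrA ger_pMr// mulrC ler_pdivrMr// mul1r ler_nat.
Qed.

Lemma atom_ssum b (M : R) : U [set n | rnorm ((b : linfty A) n) <= M] ->
  csummable (atom b) /\ ssum (fun x => rnorm (atom b x)) <= M.
Proof.
move=> bM; apply: ssum_le_fin => [x|s us]; first exact: rnorm_ge0.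
exact: sum_atom_le.
Qed.

Lemma atom_ssum_norm b : csummable (atom b) /\ ssum (fun x => rnorm (atom b x)) <= rnorm b.
Proof.
by apply: atom_ssum; apply: filterS filterT => n _; exact: ler_rnorm_linfty.
Qed.

Lemma atom_summable b : csummable (atom b). Proof. exact: (atom_ssum_norm b).1. Qed.

(* A sequence without atoms is uniformly small: otherwise picking, for each [n],
   an index where the coefficient is large would produce an atom. *)
Lemma atom_small b (e e' : R) : (forall x, rnorm (atom b x) <= e) -> e < e' ->
  U [set n | forall k, rnorm (coef b n k) <= e'].
Proof.
move=> be ee'; have [//|h] := ultra_or UU [set n | forall k, rnorm (coef b n k) <= e'].
have /choice[g gP] n : exists k : int,
    ~ (forall k, rnorm (coef b n k) <= e') -> e' < rnorm (coef b n k).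
  have [a|/existsNP[k /negP kP]] := pselect (forall k, rnorm (coef b n k) <= e').
    by exists 0.
  by exists k => _; rewrite ltNge.
have ee0 : 0 < e' - e by rewrite subr_gt0.
have [n [/= /gP h1 h2]] := filter_ex (filterI h (atomP b g ee0)).
exfalso; have := be (cl g).
have := rnormD (coef b n (g n) - atom b (cl g)) (atom b (cl g)).
by rewrite subrK; lra.
Qed.

(** The Young inequality between the supremum and l^1 norms; it makes the sequences without atoms an
    ideal. *)
Lemma coef_mul_le b c n k (e : R) : (forall j, rnorm (coef b n j) <= e) ->
  rnorm (coef (b * c) n k) <= e * rnorm c.
Proof.
move=> be; have e0 : 0 <= e by apply: le_trans (be 0); exact: rnorm_ge0.
pose a := (b : linfty A) n : ell1Z R; pose d := (c : linfty A) n : ell1Z R.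
rewrite -[coef _ _ _]/(csum (fun j => a j * d (k - j))).
have sd : csummable (fun j => d (k - j)).
  exact: (reindex_csummable (subr_bij k) (ell1ZP d)).
apply: le_trans (rnorm_csum (csummable_conv a d k)) _.
apply: (@le_trans _ _ (ssum (fun j => e * rnorm (d (k - j))))).
  apply: le_ssum; last exact: summZ.
  by move=> j; rewrite rnorm_ge0 rnormM ler_wpM2r ?rnorm_ge0 ?be.
rewrite ssumZ//; last by move=> j; exact: rnorm_ge0.
rewrite ler_wpM2l//; apply: le_trans (ler_rnorm_linfty (c : linfty A) n).
by rewrite [leRHS]rnorm_ell1Z (reindex_ssum (fun j => rnorm (d j)) (subr_bij k)).
Qed.

Lemma bounded_delta (g : nat -> int) : bounded_sequence (fun n => delta R (g n)).
Proof. by exists 1 => n; rewrite rnorm_delta. Qed.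

Definition deltas (g : nat -> int) : B := mk_linfty (bounded_delta g).

Lemma atom_deltas_mul (g : nat -> int) b y : atom (deltas g * b) y = atom b (y - cl g).
Proof.
rewrite -(hrepK y); apply: atom_unique; rewrite -hclB.
apply: is_ulim_ae (atomP b (hrep y - g)); apply: filterS filterT => n _ /=.
rewrite /coef /= -[RHS]/((delta R (g n) * (b : linfty A) n : ell1Z R) (hrep y n)).
by rewrite delta_mulE.
Qed.

Lemma atom_deltas (g : nat -> int) y : atom (deltas g) y = (y == cl g)%:R.
Proof.
rewrite -(hrepK y); apply: atom_unique; have [h|h] := ultra_or UU [set n | hrep y n = g n].
  rewrite (_ : cl _ = cl g) ?eqxx; last exact/hclP.
  apply: is_ulim_ae (is_ulim_cst UU _); apply: filterS h => n /= h.
  by rewrite /coef /= [RHS]deltaE h eqxx.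
rewrite (_ : (_ == _) = false); last first.
  apply/negP => /eqP/hclP h'; have [n []] := filter_ex (filterI h h'); exact.
apply: is_ulim_ae (is_ulim_cst UU _); apply: filterS h => n /= /eqP/negPf h.
by rewrite /coef /= [RHS]deltaE h.
Qed.

Lemma atom1 y : atom 1 y = (y == 0)%:R.
Proof.
rewrite -(hcl0 UU) -atom_deltas; congr atom; apply: linfty_ext => n.
exact/esym/delta0.
Qed.

Lemma atom_conv_summable b c y : csummable (fun x => atom b x * atom c (y - x)).
Proof.
apply: (@csummable_le _ _ _ _ (fun x => rnorm c * rnorm (atom b x))).
  2: exact/summZ/atom_summable.
move=> x; rewrite rnormM mulrC ler_wpM2r ?rnorm_ge0//.
apply: le_trans (atom_ssum_norm c).2.
apply: (ler_ssum (g := fun x => rnorm (atom c x))) (atom_summable c).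
by move=> z; exact: rnorm_ge0.
Qed.

(** Up to a small error [b] is a finite combination [p] of sequences of monomials, for which the
    formula is a translation; [b - p] has only small atoms and contributes little. *)
Lemma atomM b c y : atom (b * c) y = csum (fun x => atom b x * atom c (y - x)).
Proof.
set f := fun x => _; have sf : csummable f by exact: atom_conv_summable.
apply/eqP; rewrite -subr_eq0; apply/eqP/rnorm_eq0/eqP.
rewrite eq_le rnorm_ge0 andbT; apply/ler_addgt0Pr => e e0; rewrite add0r.
have K0 : 0 < 3 * (1 + rnorm c) by rewrite mulr_gt0// ltr_pwDl// rnorm_ge0.
(* Three portions [d * rnorm c] are spent: two on [b - p] and one on the tail of the convolution. *)
pose d := e / (3 * (1 + rnorm c)); have d0 : 0 < d by rewrite divr_gt0.
have [s us sd] := ssum_tail (fun x => rnorm_ge0 (atom b x)) (atom_summable b) d0.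
have sb' := csummable_rest (atom_summable b) s.
have tail x : rnorm (if x \in s then 0 else atom b x) <= d.
  apply: le_trans (ltW sd).
  have -> : (fun i => if i \in s then 0 else rnorm (atom b i)) =
      (fun i => rnorm (if i \in s then 0 else atom b i)).
    by apply/funext => z; case: ifP; rewrite ?rnorm0.
  apply: (ler_ssum (g := fun i => rnorm (if i \in s then 0 else atom b i))) sb' => z.
  exact: rnorm_ge0.
pose p := \sum_(x <- s) atom b x *: deltas (hrep x).
have pE x : atom (b - p) x = if x \in s then 0 else atom b x.
  rewrite atomD atomN /p atom_sum.
  under eq_bigr do rewrite atomZ atom_deltas hrepK.
  case: ifPn => xs.
    rewrite (bigD1_seq x)//= eqxx mulr1 big1_seq ?addr0 ?subrr//.
    by move=> z /andP[/negPf zx _]; rewrite eq_sym zx mulr0.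
  rewrite big1_seq ?subr0// => z /andP[_ zs].
  by case: eqP => [xz|]; rewrite ?mulr0//; rewrite xz zs in xs.
(* The atoms of [b - p] are at most [d]; the factor 2 is the strict margin required by
   [atom_small]. *)
have h1 : rnorm (atom ((b - p) * c) y) <= 2 * d * rnorm c.
  have d2 : d < 2 * d by lra.
  have h : U [set n | forall k, rnorm (coef (b - p) n k) <= 2 * d].
    by apply: atom_small d2 => x; rewrite pE.
  have := atomP ((b - p) * c) (hrep y); rewrite hrepK => /is_ulim_le; apply => //.
  by apply: filterS h => n /= h; exact: coef_mul_le.
have h2 : atom (p * c) y = \sum_(x <- s) f x.
  rewrite /p mulr_suml atom_sum; apply: eq_bigr => x _.
  by rewrite -scalerAl atomZ atom_deltas_mul hrepK.
have h3 : rnorm (csum (fun x => if x \in s then 0 else f x)) <= d * rnorm c.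
  have s3 := csummable_rest sf s.
  apply: le_trans (rnorm_csum s3) _.
  apply: (@le_trans _ _ (ssum (fun x => d * rnorm (atom c (y - x))))).
    apply: le_ssum; last exact/summZ/(reindex_csummable _ (atom_summable c))/subl_bijective.
    move=> x; rewrite rnorm_ge0/=; have := tail x; case: ifP => _ t.
      by rewrite rnorm0 mulr_ge0 ?rnorm_ge0// ltW.
    by rewrite rnormM ler_wpM2r ?rnorm_ge0.
  rewrite (ssumZ (ltW d0)); first last.
  - exact: reindex_csummable (subl_bijective y) (atom_summable c).
  - by move=> x; exact: rnorm_ge0.
  rewrite (ler_wpM2l (ltW d0))//.
  rewrite -[leLHS]/(ssum ((fun x => rnorm (atom c x)) \o (fun x => y - x))).
  rewrite -(reindex_ssum (fun x => rnorm (atom c x)) (subl_bijective y)).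
  exact: (atom_ssum_norm c).2.
have -> : atom (b * c) y - csum f =
    atom ((b - p) * c) y - csum (fun x => if x \in s then 0 else f x).
  rewrite (csum_split sf us) -h2 mulrBl atomD atomN.
  by rewrite opprD addrA.
apply: le_trans (rnormB _ _) _; apply: le_trans (lerD h1 h3) _.
have : d * (3 * (1 + rnorm c)) = e by rewrite /d divfK// gt_eqF.
have := rnorm_ge0 c; move: d0; set r := rnorm c => d0' r0 <-.
by have : 0 <= d * r := mulr_ge0 (ltW d0') r0; lra.
Qed.

End AtomicPart.

(** * Convolution of summable functions on an abelian group *)

Section Convolution.
Variables (R : realType) (V : zmodType) (p q : V -> R[i]).
Hypotheses (sp : csummable p) (sq : csummable q).

Lemma csummable2_convolution : csummable2 (fun x y => p x * q (y - x)).
Proof.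
have sqx x : csummable (fun y => q (y - x)).
  exact: (reindex_csummable (subr_bijective x) sq).
apply: (@csummable2I _ _ _ _ (fun x => ssum (fun y => rnorm (q y)) * rnorm (p x))).
3: exact: summZ.
  by move=> x; exact: csummableZ.
move=> x; under eq_fun do rewrite rnormM.
rewrite (ssumZ (rnorm_ge0 _) (fun y => rnorm_ge0 _) (sqx x)) mulrC.
by rewrite [in leRHS](reindex_ssum (fun y => rnorm (q y)) (subr_bijective x)).
Qed.

Lemma csum_convolution :
  csum (fun y => csum (fun x => p x * q (y - x))) = csum p * csum q.
Proof.
rewrite csum_swap; last exact/csummable2_swap/csummable2_convolution.
rewrite [RHS]mulrC -csumZ//; apply: eq_csum => x.
rewrite csumZ; last exact: (reindex_csummable (subr_bijective x) sq).
by rewrite -(reindex_csum q (subr_bijective x)) mulrC.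
Qed.

End Convolution.

(** * Characters of the atomic part *)

Section Characters.
Variables (R : realType) (U : set_system nat) (UU : UltraFilter U).
Local Notation A := (ell1Z_algebra R).
Local Notation B := (linfty_algebra A).
Local Notation G := (hyperint UU).
Local Notation cl := (hcl UU).
Local Notation summ g := (summable setT (fun i => (g i)%:E)).

Section OneCharacter.
Variable e : G -> R[i].
Hypotheses (eD : forall x y, e (x + y) = e x * e y) (e1 : forall x, rnorm (e x) = 1).

(** The Gelfand transform at the character [e] of the element of l^1(G) formed by the atoms of
    [b]. *)
Definition chi (b : B) : R[i] := csum (fun x => atom b x * e x).

Lemma chi_summable (b : B) : csummable (fun x => atom b x * e x).
Proof.
by apply: csummable_le (atom_summable UU b) => x; rewrite rnormM e1 mulr1.
Qed.

Lemma chiD (b c : B) : chi (b + c) = chi b + chi c.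
Proof.
rewrite /chi -csumD; [|exact: chi_summable..].
by apply: eq_csum => x; rewrite atomD mulrDl.
Qed.

Lemma chiZ (k : R[i]) (b : B) : chi (k *: b) = k * chi b.
Proof.
rewrite /chi -csumZ; last exact: chi_summable.
by apply: eq_csum => x; rewrite atomZ mulrA.
Qed.

Lemma chiB (b c : B) : chi (b - c) = chi b - chi c.
Proof. by rewrite chiD -scaleN1r chiZ mulN1r. Qed.

Lemma chi_deltas (g : nat -> int) : chi (deltas R g) = e (cl g).
Proof.
rewrite /chi (csum_single (a := cl g)); first by rewrite atom_deltas eqxx mul1r.
by move=> x /negPf xg; rewrite atom_deltas xg mul0r.
Qed.

Lemma chiM (b c : B) : chi (b * c) = chi b * chi c.
Proof.
rewrite /chi -csum_convolution; [|exact: chi_summable..].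
apply: eq_csum => y; rewrite atomM mulrC -csumZ; last exact: atom_conv_summable.
(* The character splits as [e y = e x * e (y - x)], which matches the convolution. *)
apply: eq_csum => x; rewrite mulrACA -eD [x + _]addrC subrK mulrC.
by [].
Qed.

Lemma chi1 : chi 1 = 1.
Proof.
have e0 : e 0 = 1.
  have en0 : e 0 != 0.
    by apply/eqP => h; have := e1 0; rewrite h rnorm0 => /esym/eqP; rewrite oner_eq0.
  by apply: (mulfI en0); rewrite -eD addr0 mulr1.
rewrite /chi (csum_single (a := 0)); first by rewrite atom1 eqxx mul1r.
by move=> x /negPf x0; rewrite atom1 x0 mul0r.
Qed.

Lemma chi_le (b : B) (M : R) :
  U [set n | rnorm ((b : linfty A) n) <= M] -> rnorm (chi b) <= M.
Proof.
move=> bM; apply: le_trans (rnorm_csum (chi_summable b)) _.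
under eq_fun do rewrite rnormM e1 mulr1.
exact: (@atom_ssum _ _ UU _ _ bM).2.
Qed.

Lemma chi_ae (b c : B) :
  (forall r : R, 0 < r -> U [set n | rnorm ((b : linfty A) n - (c : linfty A) n) < r]) ->
  chi b = chi c.
Proof. by move=> bc; apply: eq_csum => x; rewrite (atom_ae bc). Qed.

End OneCharacter.

(** Integer sequences embed in the real vector space of real sequences, where [W] consists of the
    sequences equal to a multiple of [w] along [U]. The hypothesis says that [v] is outside [W], so
    a linear functional separates them. *)
Lemma additive_functional (v w : nat -> int) :
  (forall k : R, ~ U [set n | (v n)%:~R = k * (w n)%:~R]) ->
  exists f : G -> R, [/\ forall x y, f (x + y) = f x + f y, f (cl v) = 1 & f (cl w) = 0].
Proof.
move=> vw.
pose real (g : nat -> int) : nat -> R^o := fun n => (g n)%:~R.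
pose W := [set x : nat -> R^o | exists k : R, U [set n | x n = k * (w n)%:~R]].
have [|c x y [k xk] [l yl]|/=|f [flin fv fW]] :=
    @linear_functional R (nat -> R^o)%type W (real v).
- by exists 0; apply: filterS filterT => n _; exact/esym/mul0r.
- exists (c * k + l); apply: filterS (filterI xk yl) => n [/= xn yn].
  by rewrite mulrDl -mulrA -xn -yn.
- by move=> [k vk]; exact: vw vk.
(* Sequences vanishing along [U] lie in [W], with [k = 0], so [f] descends to [G]. *)
have f_ae (x y : nat -> R^o) : U [set n | x n = y n] -> f x = f y.
  move=> xy; have -> : x = 1 *: (x - y) + y by rewrite scale1r subrK.
  rewrite flin mul1r fW ?add0r//; exists 0; apply: filterS xy => n /= xy; rewrite mul0r.
  exact: etrans (congr1 (fun a : R => a - y n) xy) (subrr _).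
have fcl g : f (real (hrep (cl g))) = f (real g).
  apply: f_ae; have /hclP : cl (hrep (cl g)) = cl g by rewrite hrepK.
  by apply: filterS => n /= h; rewrite /real h.
exists (fun x => f (real (hrep x))); split.
- move=> x y; have -> : f (real (hrep (x + y))) = f (real (hrep x + hrep y)).
    by rewrite -[in RHS]fcl hclD !hrepK.
  rewrite -[f (real (hrep x))]mul1r -flin scale1r; congr f; apply/funext => n.
  exact: intrD.
- by rewrite fcl.
- by rewrite fcl; apply: fW; exists 1; apply: filterS filterT => n _; exact/esym/mul1r.
Qed.

Variables (f1 f2 : G -> R).
Hypotheses (f1D : forall x y, f1 (x + y) = f1 x + f1 y)
  (f2D : forall x y, f2 (x + y) = f2 x + f2 y).

Definition plane_char (s t : R) (x : G) : R[i] := cis (s * f1 x + t * f2 x).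

Lemma plane_charD s t x y : plane_char s t (x + y) = plane_char s t x * plane_char s t y.
Proof. by rewrite /plane_char -cisD f1D f2D !mulrDr addrACA. Qed.

Lemma rnorm_plane_char s t x : rnorm (plane_char s t x) = 1.
Proof. exact: rnorm_cis. Qed.

(** [f1] and [f2] need not be bounded on [G], but the atoms of [b] have small total mass outside a
    finite set [S], on which the characters vary uniformly little. *)
Lemma chi_uniform (b : B) (e : R) : 0 < e ->
  exists2 r : R, 0 < r & forall s t s' t', `|s - s'| < r -> `|t - t'| < r ->
    rnorm (chi (plane_char s t) b - chi (plane_char s' t') b) < e.
Proof.
move=> e0; have sb := atom_summable UU b.
(* Two unimodular values differ by at most 2, so the part outside [S] costs less than [e / 3]. *)
have e6 : 0 < e / 6 by rewrite divr_gt0.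
have M0 : 0 < 3 * (1 + rnorm b) by rewrite mulr_gt0// ltr_pwDl// rnorm_ge0.
have [S uS Se] := ssum_tail (fun x : G => rnorm_ge0 (atom b x)) sb e6.
pose k := e / (3 * (1 + rnorm b)); have k0 : 0 < k by rewrite divr_gt0.
have [q q0 qP] := cis_near0 k0.
(* [C] bounds [|f1| + |f2|] on [S], so parameters closer than [q / (C + 1)] change the phase there
   by less than [q]. *)
pose C := \sum_(x <- S) (`|f1 x| + `|f2 x|).
have C0 : 0 <= C by apply: sumr_ge0 => x _; rewrite addr_ge0.
have C1 : 0 < C + 1 by rewrite ltr_wpDl.
exists (q / (C + 1)); first by rewrite divr_gt0.
move=> s t s' t' ss' tt'.
have inS x : x \in S -> rnorm (plane_char s t x - plane_char s' t' x) <= k.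
  move=> xS; pose u := (s - s') * f1 x + (t - t') * f2 x.
  have -> : plane_char s t x - plane_char s' t' x = plane_char s' t' x * (cis u - 1).
    rewrite mulrBr mulr1 /plane_char -cisD; congr (cis _ - _).
    by rewrite /u !mulrBl [RHS]addrACA ![_ + (_ - _)]addrC !subrK.
  rewrite rnormM rnorm_plane_char mul1r; apply/ltW/qP.
  apply: le_lt_trans (ler_normD _ _) _; rewrite !normrM.
  apply: (@le_lt_trans _ _ (q / (C + 1) * (`|f1 x| + `|f2 x|))).
    by rewrite mulrDr lerD// ler_wpM2r// ltW.
  apply: (@le_lt_trans _ _ (q / (C + 1) * C)).
    rewrite (ler_wpM2l (ltW (divr_gt0 q0 C1)))//.
    rewrite /C (bigD1_seq x)//= lerDl; apply: sumr_ge0 => y _; exact: addr_ge0.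
  by rewrite -mulrA gtr_pMr// mulrC ltr_pdivrMr// mul1r ltrDl.
rewrite -[chi _ b - _]/(csum _ - csum _) -[- csum _]csumN.
  2: exact/chi_summable/rnorm_plane_char.
rewrite -csumD; [|exact/chi_summable/rnorm_plane_char
  |exact/csummableN/chi_summable/rnorm_plane_char].
pose g (x : G) :=
  k * rnorm (atom b x) + 2 * (if x \in S then 0 else rnorm (atom b x)).
have s1 : summ (fun x => k * rnorm (atom b (x : G))) by exact: summZ.
have st : summ (fun x => if x \in S then 0 else rnorm (atom b (x : G))).
  by apply: summ_le sb => x; case: ifP => _; rewrite ?normr0 ?ger0_norm ?rnorm_ge0.
have s2 := summZ 2 st.
have sg : summ g by exact: summD.
have le x : rnorm (atom b x * plane_char s t x - atom b x * plane_char s' t' x) <= g x.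
  rewrite -mulrBr rnormM /g mulrC; have a0 := rnorm_ge0 (atom b x).
  case: ifPn => xS; first by rewrite mulr0 addr0 ler_wpM2r// inS.
  rewrite (@le_trans _ _ (2 * rnorm (atom b (x : G))))//; last by rewrite lerDr mulr_ge0// ltW.
  rewrite ler_wpM2r//; apply: le_trans (rnormB _ _) _.
  by rewrite !rnorm_plane_char.
apply: le_lt_trans (rnorm_csum (csummable_le le sg)) _.
apply: le_lt_trans (le_ssum _ sg) _; first by move=> x; rewrite rnorm_ge0 le.
rewrite ssumD//; last 2 first.
- by move=> x; rewrite mulr_ge0 ?rnorm_ge0// ltW.
- by move=> x; case: ifP => _; rewrite ?mulr0 ?mulr_ge0 ?rnorm_ge0.
rewrite (ssumZ (ltW k0) (fun x => rnorm_ge0 _) sb) (ssumZ _ _ st)//.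
  2: by move=> x; case: ifP; rewrite ?rnorm_ge0.
have h1 : k * ssum (fun x => rnorm (atom b (x : G))) <= e / 3.
  apply: le_trans (ler_wpM2l (ltW k0) (atom_ssum_norm UU b).2) _.
  have -> : k * rnorm b = e / 3 * (rnorm b / (1 + rnorm b)).
    by rewrite /k invfM !mulrA [LHS]mulrAC.
  have r0 : 0 < 1 + rnorm b by rewrite ltr_pwDl// rnorm_ge0.
  by rewrite ger_pMr ?divr_gt0// ler_pdivrMr// mul1r lerDr.
by lra.
Qed.

End Characters.

(** * The obstruction *)

Section Obstruction.
Variable R : realType.
Local Notation A := (ell1Z_algebra R).
Local Notation B := (linfty_algebra A).

Let one : nat -> int := fun=> 1.
Let idn : nat -> int := fun n => n%:Z.

(** [0 -i* 1] is [-i]. The constant sequence [one] carries the parameter [s] and [idn] carries [t],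
    as [chi_sin_plane] shows. *)
Definition sin_plane : B :=
  (0 -i* 1) *: (deltas R one - deltas R (- one)) + (deltas R idn - deltas R (- idn)).

Section Ultra.
Variables (U : set_system nat) (UU : UltraFilter U).
Hypothesis oo : \oo `<=` U.
Local Notation G := (hyperint UU).
Local Notation cl := (hcl UU).

(** Every set of [U] contains two indices [n < m], and no single scalar [k] satisfies either
    relation at both. *)
Lemma independent_one_idn :
  (forall k : R, ~ U [set n | (one n)%:~R = k * (idn n)%:~R]) /\
  (forall k : R, ~ U [set n | (idn n)%:~R = k * (one n)%:~R]).
Proof.
have two (P : set nat) : U P -> exists n m, [/\ P n, P m & (n < m)%N].
  move=> UP; have [n Pn] := filter_ex UP.
  have Un : U [set m | (n < m)%N] by apply: oo; exists n.+1.
  by have [m [Pm nm]] := filter_ex (filterI UP Un); exists n, m.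
split=> k /two[n [m [/= e1 e2 nm]]].
  have k0 : k != 0 by apply/eqP => k0; move/eqP: e1; rewrite k0 mul0r oner_eq0.
  move: e2; rewrite e1 => /(mulfI k0) /intr_inj [nm'].
  by rewrite nm' ltnn in nm.
by move: e1; rewrite -e2 => /intr_inj [nm']; rewrite nm' ltnn in nm.
Qed.

Lemma chi_sin_plane (f1 f2 : G -> R) (s t : R) :
  (forall x y, f1 (x + y) = f1 x + f1 y) -> (forall x y, f2 (x + y) = f2 x + f2 y) ->
  f1 (cl one) = 1 -> f1 (cl idn) = 0 -> f2 (cl one) = 0 -> f2 (cl idn) = 1 ->
  chi (plane_char f1 f2 s t) sin_plane = (2 * sin s) +i* (2 * sin t).
Proof.
move=> f1D f2D f11 f1n f21 f2n.
have fN (f : G -> R) : (forall x y, f (x + y) = f x + f y) -> forall x, f (- x) = - f x.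
  move=> fD x; have f0 : f 0 = 0 by apply: (addrI (f 0)); rewrite -fD !addr0.
  by apply/eqP; rewrite -addr_eq0 -fD addNr f0.
have e1 := rnorm_plane_char f1 f2 s t.
rewrite /sin_plane chiD// chiZ// !chiB// !chi_deltas !hclN /plane_char.
rewrite !(fN _ f1D) !(fN _ f2D) f11 f1n f21 f2n.
rewrite !mulrN !mulr1 !mulr0 !oppr0 !addr0 !add0r /cis !cosN !sinN.
apply/eqP; rewrite eq_complex /=; apply/andP; split; apply/eqP; ring.
Qed.

(** The hypotheses ask for closeness and a right inverse only along [U], which covers the bounded
    sequences and all reduced powers over the cofinite filter at once. *)
Lemma sin_plane_isolated (b c : B) :
  U [set n | rnorm ((b : linfty A) n - (sin_plane : linfty A) n) <= 1] ->
  (forall e : R, 0 < e ->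
    U [set n | rnorm (((b * c : B) : linfty A) n - ((1 : B) : linfty A) n) < e]) ->
  False.
Proof.
move=> b1 bc; have [v1 v2] := independent_one_idn.
have [f1 [f1D f11 f1n]] := additive_functional UU v1.
have [f2 [f2D f2n f21]] := additive_functional UU v2.
pose F s t := chi (plane_char f1 f2 s t) b.
have e1 := rnorm_plane_char f1 f2; have eD := plane_charD f1D f2D.
have K0 : 0 < 1 + rnorm c by rewrite ltr_pwDl// rnorm_ge0.
(* The transforms of [b] and [c] have product 1 and that of [c] is at most [1 + rnorm c], which
   bounds [F] from below. *)
pose d := (1 + rnorm c)^-1; have d0 : 0 < d by rewrite invr_gt0.
have Fd s t : d <= rnorm (F s t).
  have h : rnorm (F s t) * rnorm (chi (plane_char f1 f2 s t) c) = 1.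
    by rewrite -rnormM -chiM// (chi_ae _ bc) chi1// rnorm1.
  have hc : rnorm (chi (plane_char f1 f2 s t) c) <= 1 + rnorm c.
    rewrite (@le_trans _ _ (rnorm c)) ?lerDr//; apply: chi_le => //.
    by apply: filterS filterT => n _; exact: ler_rnorm_linfty.
  rewrite /d -[leLHS]mul1r ler_pdivrMr// -[leLHS]h.
  by rewrite ler_wpM2l ?rnorm_ge0.
have Fa s t : rnorm (F s t - ((2 * sin s) +i* (2 * sin t))) <= 1.
  rewrite -(chi_sin_plane s t f1D f2D f11 f1n f21 f2n) /F -chiB//.
  exact: chi_le.
have FRe s t : `|complex.Re (F s t) - 2 * sin s| <= 1.
  by have := le_trans (ler_Re_rnorm _) (Fa s t); case: (F s t).
have FIm s t : `|complex.Im (F s t) - 2 * sin t| <= 1.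
  by have := le_trans (ler_Im_rnorm _) (Fa s t); case: (F s t).
have d8 : 0 < d / 8 by rewrite divr_gt0.
have [r r0 rP] := chi_uniform f1 f2 b d8.
pose N := Num.bound (pi / r).
have pi0 : 0 < pi :> R := pi_gt0 R.
have Nr : pi / r < N%:R by apply: archi_boundP; rewrite ltW// divr_gt0.
have N0 : 0 < N%:R :> R by apply: lt_trans Nr; rewrite divr_gt0.
(* The subdivision of [[-pi/2, pi/2]] into [N] steps, each shorter than [r] by the choice of [N]. *)
pose p (i : nat) : R := - (pi / 2) + i%:R * (pi / N%:R).
have pS i : `|p i.+1 - p i| < r.
  have -> : p i.+1 - p i = pi / N%:R by rewrite /p -addn1 natrD; ring.
  rewrite ger0_norm; last by rewrite ltW// divr_gt0.
  by rewrite ltr_pdivrMr// mulrC -ltr_pdivrMr.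
have p0 : sin (p 0%N) = -1 by rewrite /p mul0r addr0 sinN sin_pihalf.
have pN : sin (p N) = 1.
  have -> : p N = pi / 2 by rewrite /p mulrCA divff ?gt_eqF//; lra.
  exact: sin_pihalf.
(* On each side of the square the relevant coordinate of [F] is within 1 of [-2] or [2], which fixes
   its sign. *)
apply: (@grid_zero R N (fun i j => F (p i) (p j)) d) => //.
- by move=> i j _ _; apply: rP; rewrite ?subrr ?normr0.
- by move=> i j _ _; apply: rP; rewrite ?subrr ?normr0.
- by move=> j _; have := FRe (p 0%N) (p j); rewrite p0 ler_norml => /andP[]; lra.
- by move=> j _; have := FRe (p N) (p j); rewrite pN ler_norml => /andP[]; lra.
- by move=> i _; have := FIm (p i) (p 0%N); rewrite p0 ler_norml => /andP[]; lra.
- by move=> i _; have := FIm (p i) (p N); rewrite pN ler_norml => /andP[]; lra.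
Qed.

End Ultra.

Lemma linfty_not_stable_rank_one : ~ stable_rank_one B.
Proof.
move=> /stable_rank_oneP/(_ sin_plane 1 ltr01)[b [c [bc _]] ab].
have [U [UU oo]] := ultraFilterLemma eventually_filter.
apply: (@sin_plane_isolated U UU oo b c) => [|e e0].
  apply: filterS filterT => n _ /=; apply: le_trans (ltW ab).
  by rewrite [leRHS]rnorm_distC; exact: (ler_rnorm_linfty (b - sin_plane) n).
by rewrite bc; apply: filterS filterT => n _ /=; rewrite subrr rnorm0.
Qed.

(** An approximant in the quotient lifts to a sequence uniformly within 1 of [sin_plane], and an
    equation modulo the null ideal of [F] persists along any ultrafilter [U] finer than [F]. *)
Lemma reduced_power_not_stable_rank_one (F : set_system nat) (FF : ProperFilter F) :
  \oo `<=` F -> ~ stable_rank_one (reduced_power A FF).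
Proof.
move=> ooF /stable_rank_oneP.
pose I := null_closedIdeal A FF.
move=> /(_ (qpi I sin_plane) 1 ltr01)[y [z [yz _]] ay].
have [U [UU FU]] := ultraFilterLemma FF.
have [d [dE d1]] : exists d : B, qpi I d = y - qpi I sin_plane /\ rnorm d < 1.
  have e0 : 0 < 1 - rnorm (qpi I sin_plane - y) by rewrite subr_gt0.
  have [d [dE dlt]] := rnorm_lift (y - qpi I sin_plane : quotient I) e0.
  exists d; split=> //; apply: lt_le_trans dlt _.
  by rewrite [X in X + _]rnorm_distC addrC subrK.
pose b := sin_plane + d.
pose c : B := repr (z : {ideal_quot (ideal_left I)}).
have bE : qpi I b = y by rewrite qpiD dE addrC subrK.
have cE : qpi I c = z by exact: qpiK.
have : qpi I (b * c) = qpi I 1 by rewrite -qpiM bE cE; exact: yz.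
move=> /qpiP /null_sequenceP bc.
apply: (@sin_plane_isolated U UU (subset_trans ooF FU) b c) => [|e /bc/FU//].
apply: filterS filterT => n _ /=; rewrite addrC addKr.
exact: le_trans (ler_rnorm_linfty d n) (ltW d1).
Qed.

End Obstruction.

(** An ultrafilter containing a singleton is principal, so [U] contains the complements of points
    and their finite intersections. *)
Lemma nonprincipal_cofinite (U : set_system nat) :
  UltraFilter U -> nonprincipal U -> \oo `<=` U.
Proof.
move=> UU npU; have co n : U (~` [set n]).
  have [Un|//] := in_ultra_setVsetC [set n] UU.
  exfalso; apply: (npU n); apply/seteqP; split=> S.
    by move=> US; have [_ [/= -> Sn]] := filter_ex (filterI Un US); exact/principal_filterP.
  by move=> /principal_filterP Sn; apply: filterS Un => _ ->.
have tail N : U [set n | (N <= n)%N].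
  elim: N => [|N IH]; first by apply: filterS filterT.
  apply: filterS (filterI IH (co N)) => n [/= Nn nN].
  by rewrite ltn_neqAle Nn andbT eq_sym; exact/eqP.
by move=> S [N _ NS]; apply: filterS (tail N) => n; exact: NS.
Qed.

Theorem theorem5p10 (R : realType) :
  stable_rank_one (ell1Z_algebra R) /\
  (forall (U : set_system nat) (UU : UltraFilter U), nonprincipal U ->
     ~ stable_rank_one (ultrapower (ell1Z_algebra R) UU)) /\
  ~ stable_rank_one (Asy (ell1Z_algebra R)) /\
  ~ stable_rank_one (linfty_algebra (ell1Z_algebra R)).
Proof.
split; first exact: ell1Z_stable_rank_one.
split; last split.
- move=> U UU npU; apply: reduced_power_not_stable_rank_one.
  exact: nonprincipal_cofinite.
- exact: reduced_power_not_stable_rank_one.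
- exact: linfty_not_stable_rank_one.
Qed.
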